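(* Consider the partial-data GROUSE algorithm described in the context, with step length chosen so that $\sin(\sigma_t\eta_t)=\|r_t\|/\|p_t\|$. Suppose that $|\Omega_t|\ge q$ for all $t$, where $q$ and $C_1$ satisfy $$q\ \ge\ C_1(\log n)^2\, d\,\mu(\bar U)\log(20d),\qquad C_1\ge \tfrac{64}{3}.$$ Suppose that $$\epsilon_t\le \frac{1}{128}\frac{q^2}{n^2 d}\qquad\text{and}\qquad \epsilon_t\le \frac{d}{16 n}\,\mu(\bar U).$$ Suppose that there is a quantity $\bar\delta\in(0,0.6)$ such that, with probability at least $1-\bar\delta$, the vector $x_t:=v_t-U_tU_t^Tv_t$ satisfies both $$\mu(x_t)\le \log n\left[\frac{0.045}{\log 10}\,C_1\, d\,\mu(\bar U)\log(20d)\right]^{1/2}\quad\text{and}\quad \mu(x_t)\le(\log n)^2\left[\frac{0.05}{8\log 10}\,C_1\log(20d)\right].$$ Suppose that at each iteration $s_t$ is a random vector whose components are i.i.d. $\mathcal N(0,1)$. Then $$E[\epsilon_{t+1}\mid\epsilon_t]\ \le\ \epsilon_t-(0.32)(0.6-\bar\delta)\frac{q}{nd}\,\epsilon_t+55\sqrt{\frac{n}{q}}\;\epsilon_t^{3/2}.$$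
   Context: Let $d\ge1$ and $n\ge 2d$ be integers. $\bar U\in\mathbb R^{n\times d}$ has orthonormal columns spanning the target subspace $\mathcal S\subset\mathbb R^n$. $\|\cdot\|$ is the Euclidean (or spectral) norm, $\|\cdot\|_F$ the Frobenius norm, $\log$ the natural logarithm. For an index set $\Omega\subset\{1,\dots,n\}$ with complement $\Omega^c$, $[U]_\Omega$ denotes the submatrix of rows of $U$ indexed by $\Omega$ and $[z]_\Omega$ the corresponding subvector of $z\in\mathbb R^n$. Error measure: for $U_t\in\mathbb R^{n\times d}$ with orthonormal columns, $\epsilon_t:=d-\|\bar U^TU_t\|_F^2=\sum_{i=1}^d\sin^2\phi_i$, where $\cos\phi_i$ are the singular values of $\bar U^TU_t$. Coherence: for $U\in\mathbb R^{n\times d}$ with orthonormal columns, $\mu(U):=\frac nd\max_{1\le i\le n}\|U_{i\cdot}\|_2^2$ where $U_{i\cdot}$ is the $i$th row; for a nonzero vector $x\in\mathbb R^n$, $\mu(x):=n\|x\|_\infty^2/\|x\|_2^2$. Sampling: at each iteration the random index set $\Omega_t\subset\{1,\dots,n\}$ is chosen uniformly with replacement at random, independently at each iteration. GROUSE iteration $t$ (partial data): given the current $U_t$ with orthonormal columns, $\Omega_t$ is drawn and $[v_t]_{\Omega_t}$ is observed, where $v_t=\bar U s_t\in\mathcal S$ with $s_t\in\mathbb R^d$ random. If all eigenvalues of $[U_t]_{\Omega_t}^T[U_t]_{\Omega_t}$ lie in $[0.5|\Omega_t|/n,\,1.5|\Omega_t|/n]$, set $w_t:=\arg\min_w\|[U_t]_{\Omega_t}w-[v_t]_{\Omega_t}\|_2^2$,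 $p_t:=U_tw_t$, define $r_t\in\mathbb R^n$ by $[r_t]_{\Omega_t}:=[v_t]_{\Omega_t}-[p_t]_{\Omega_t}$, $[r_t]_{\Omega_t^c}:=0$, set $\sigma_t:=\|r_t\|\,\|p_t\|$, choose $\eta_t>0$ (with $\sigma_t\eta_t\in[0,\pi/2]$) and set $$U_{t+1}:=U_t+\left[(\cos(\sigma_t\eta_t)-1)\frac{p_t}{\|p_t\|}+\sin(\sigma_t\eta_t)\frac{r_t}{\|r_t\|}\right]\frac{w_t^T}{\|w_t\|}.$$ If the eigenvalue condition fails, no step is taken and $\epsilon_{t+1}=\epsilon_t$. *)

(* Defs.v *)
From HB Require Import structures.
From mathcomp Require Import all_boot all_order all_algebra.
From mathcomp Require Import all_classical all_reals all_analysis.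

Set Implicit Arguments.
Unset Strict Implicit.
Unset Printing Implicit Defensive.

Import Order.TTheory GRing.Theory Num.Theory.
Import numFieldNormedType.Exports.

Local Open Scope classical_set_scope.
Local Open Scope ring_scope.

Section Deterministic.
Context {R : realType}.

Definition orthonormal_cols n d (U : 'M[R]_(n, d)) : Prop := U^T *m U = 1%:M.

(* Frobenius norm; on a row or a column vector this is the Euclidean norm. *)
Definition l2norm m n (A : 'M[R]_(m, n)) : R :=
  Num.sqrt (\sum_(i < m) \sum_(j < n) A i j ^+ 2).

Definition subspace_err n d (Ubar U : 'M[R]_(n, d)) : R :=
  d%:R - l2norm (Ubar^T *m U) ^+ 2.

Definition coherence n d (U : 'M[R]_(n, d)) : R :=
  n%:R / d%:R * \big[Num.max/0]_(i < n) l2norm (row i U) ^+ 2.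

(* By the convention 0^-1 = 0, the value at x = 0 is 0. *)
Definition vcoherence n (x : 'cV[R]_n) : R :=
  n%:R * (\big[Num.max/0]_(i < n) `|x i 0|) ^+ 2 / l2norm x ^+ 2.

(* The submatrix [A]_S: enum_val lists the elements of S in increasing order. *)
Definition rows_in n k (S : {set 'I_n}) (A : 'M[R]_(n, k)) : 'M[R]_(#|S|, k) :=
  rowsub (fun j : 'I_#|S| => enum_val j) A.

(* The condition under which GROUSE takes a step. *)
Definition well_sampled n d (S : {set 'I_n}) (U : 'M[R]_(n, d)) : Prop :=
  forall a : R, eigenvalue ((rows_in S U)^T *m rows_in S U) a ->
    1 / 2 * (#|S|%:R / n%:R) <= a <= 3 / 2 * (#|S|%:R / n%:R).

Definition is_lsq_argmin n d (S : {set 'I_n}) (U : 'M[R]_(n, d))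
    (v : 'cV[R]_n) (w : 'cV[R]_d) : Prop :=
  forall w' : 'cV[R]_d,
    l2norm (rows_in S U *m w - rows_in S v) ^+ 2 <=
    l2norm (rows_in S U *m w' - rows_in S v) ^+ 2.

Definition residual n (S : {set 'I_n}) (v p : 'cV[R]_n) : 'cV[R]_n :=
  \col_i (if i \in S then v i 0 - p i 0 else 0).

(* A quotient by a zero norm is 0 here: the term in r / |r| is absent when
   r = 0, and no step is made when w = 0. *)
Definition grouse_update n d (U : 'M[R]_(n, d)) (w : 'cV[R]_d) (r : 'cV[R]_n)
    (sigma eta : R) : 'M[R]_(n, d) :=
  let p := U *m w in
  U + ((cos (sigma * eta) - 1) *: ((l2norm p)^-1 *: p)
       + sin (sigma * eta) *: ((l2norm r)^-1 *: r))
      *m ((l2norm w)^-1 *: w^T).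

(* The probability that N indices drawn uniformly and independently from
   'I_n, with replacement, have S as their set of values. *)
Definition replacement_prob n (N : nat) (S : {set 'I_n}) : R :=
  #|[pred f : {ffun 'I_N -> 'I_n} | f @: 'I_N == S]|%:R / (n ^ N)%N%:R.

(* The two upper bounds required of the current error e. *)
Definition small_error n d (Ubar : 'M[R]_(n, d)) (q e : R) : Prop :=
  e <= 1 / 128 * (q ^+ 2 / (n%:R ^+ 2 * d%:R)) /\
  e <= d%:R / (16 * n%:R) * coherence Ubar.

End Deterministic.

Section Stochastic.
Context {d0 : measure_display} {T : measurableType d0} {R : realType}.
Variable P : probability T R.

Definition sigma_of (X : T -> R) : set (set T) :=
  preimage_set_system setT X measurable.

(* Y is a version of the conditional expectation E[X | G]. *)
Definition is_cond_exp (G : set (set T)) (X Y : T -> R) : Prop :=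
  [/\ P.-integrable setT (EFin \o X),
      P.-integrable setT (EFin \o Y),
      sigma_of Y `<=` G
    & forall A, G A ->
        (\int[P]_(x in A) (Y x)%:E = \int[P]_(x in A) (X x)%:E)%E].

(* Given that it has at least q elements, Om is distributed as the set of
   values of N uniform draws with replacement. Unconditionally, N >= 1 draws
   are all equal with positive probability, so for q > 1 the assumption
   |Om| >= q has to act on the law of Om. *)
Definition drawn_with_replacement n (N : nat) (q : R) (Om : T -> {set 'I_n}) :
    Prop :=
  forall S : {set 'I_n}, q <= #|S|%:R ->
    P (Om @^-1` [set S]) =
    (replacement_prob N S /
     \sum_(S' : {set 'I_n} | (q <= #|S'|%:R)%R) replacement_prob N S')%:E.

Section Process.
Variables (n d : nat).
Variables (U : nat -> 'I_n -> 'I_d -> {RV P >-> R})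
          (s : nat -> 'I_d -> {RV P >-> R})
          (Om : nat -> T -> {set 'I_n}).

Definition iterate t (x : T) : 'M[R]_(n, d) := \matrix_(i, k) U t i k x.

Definition weights t (x : T) : 'cV[R]_d := \col_k s t k x.

(* Generated by the iterates up to time t and by the data (s_j, Om_j) that
   were used before time t. *)
Definition history t : set (set T) :=
  <<s [set A | (exists j i k B, [/\ (j <= t)%N, measurable B
                                  & A = U j i k @^-1` B])
            \/ (exists j k B, [/\ (j < t)%N, measurable B
                                & A = s j k @^-1` B])
            \/ (exists j E, (j < t)%N /\ A = Om j @^-1` E)] >>.

(* The history at time t, the components of s_t and the index set Om_t are
   mutually independent. *)
Definition fresh_data t : Prop :=
  forall (A : set T) (B : 'I_d -> set R) (E : set {set 'I_n}),
    history t A -> (forall k, measurable (B k)) ->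
    P (A `&` (\bigcap_(k in [set: 'I_d]) (s t k @^-1` B k)) `&` (Om t @^-1` E))
    = (P A * (\prod_(k < d) P (s t k @^-1` B k)) * P (Om t @^-1` E))%E.

Definition observed (Ubar : 'M[R]_(n, d)) t (x : T) : 'cV[R]_n :=
  Ubar *m weights t x.

Definition error (Ubar : 'M[R]_(n, d)) t (x : T) : R :=
  subspace_err Ubar (iterate t x).

(* x_t, the component of v_t orthogonal to the range of U_t. *)
Definition orth_part (Ubar : 'M[R]_(n, d)) t (x : T) : 'cV[R]_n :=
  observed Ubar t x
  - iterate t x *m (iterate t x)^T *m observed Ubar t x.

Variables (w : nat -> T -> 'cV[R]_d) (eta : nat -> T -> R).

Definition fit t (x : T) : 'cV[R]_n := iterate t x *m w t x.

Definition resid (Ubar : 'M[R]_(n, d)) t (x : T) : 'cV[R]_n :=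
  residual (Om t x) (observed Ubar t x) (fit t x).

Definition step_sigma (Ubar : 'M[R]_(n, d)) t (x : T) : R :=
  l2norm (resid Ubar t x) * l2norm (fit t x).

Record grouse_run (Ubar : 'M[R]_(n, d)) (N : nat -> nat) (q : R) : Prop := {
  grouse_init : forall x, orthonormal_cols (iterate 0 x);
  grouse_Om_measurable : forall t S, measurable (Om t @^-1` [set S]);
  grouse_fresh : forall t, fresh_data t;
  grouse_sampling : forall t, drawn_with_replacement (N t) q (Om t);
  grouse_lsq : forall t x, well_sampled (Om t x) (iterate t x) ->
    is_lsq_argmin (Om t x) (iterate t x) (observed Ubar t x) (w t x);
  grouse_eta : forall t x, well_sampled (Om t x) (iterate t x) ->
    0 < eta t x /\ 0 <= step_sigma Ubar t x * eta t x <= pi / 2;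
  grouse_step : forall t x, well_sampled (Om t x) (iterate t x) ->
    iterate t.+1 x = grouse_update (iterate t x) (w t x) (resid Ubar t x)
                       (step_sigma Ubar t x) (eta t x);
  grouse_skip : forall t x, ~ well_sampled (Om t x) (iterate t x) ->
    iterate t.+1 x = iterate t x
}.

End Process.
End Stochastic.

(* Main.v *)
(** Write [eps = |X|^2] with [X = (1 - U U^T) Ubar].  When the sampled Gram
    matrix of [U] has its spectrum in the prescribed interval, one step with
    [sin theta = |r| / |p|] lowers the error by [|r|^2 / |p|^2], up to a term
    [10 (n/q)^(1/2) eps^(3/2)].  The normal equations give
    [|r|^2 >= |x_S|^2 - (2n/|S|) |U_S^T x_S|^2] for [x = X s], and
    [|p|^2 <= (81/64) |s|^2].  For Gaussian [s] independent of the past and of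
    the sample, [E[s_i s_j / |s|^2]] is [1/d] if [i = j] and [0] otherwise, so
    the expected decrease is at least [64/(81 d)] times the average over [S] of
    the corresponding traces.

    The law of the sample is invariant under exchanging two indices.  Swapping
    an index in [S] with one outside [S] is an exchangeable pair: it gives the
    second moment of [U_S^T X_S] and a recursion on the even moments of
    [U_S^T U_S - (|S|/n)], whence, at a moment of order [ln n], a bound on the
    probability that the spectral condition fails.

    Finally, if the conditional expectation exceeded the bound on a nonnegligible
    event of the sigma-algebra of [eps_t], integrating over that event would
    contradict the estimate in expectation. *)

Require Import Defs.
From HB Require Import structures.
From mathcomp Require Import all_boot all_order all_algebra perm.
From mathcomp Require Import all_classical all_reals all_analysis.
From mathcomp Require Import measurable_realfun.
From mathcomp Require Import ring lra zify.

Set Implicit Arguments.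
Unset Strict Implicit.
Unset Printing Implicit Defensive.

Import Order.TTheory GRing.Theory Num.Theory.
Import numFieldNormedType.Exports.

Local Open Scope classical_set_scope.
Local Open Scope ring_scope.

(** Requiring at least [q] distinct indices destroys the independence of the draws, so concentration
    for sums of independent matrices does not apply. Invariance under swaps survives, and it yields
    a recursion between consecutive even moments. Its order is [P], the integer part of [ln n]:
    large enough for [3^-P] to be of order [1/n], small enough because one of the two factors [ln n]
    in [q] pays for [P] and the other, at least 6, for the constants.

    The weights [w] and the step [eta] come without any measurability. Hence one step is first
    bounded pathwise by a function of [U_t], of the sample and of the direction [s/|s|] alone, and
    only that function is averaged. Since [|p|^2] is compared with [|s|^2], the Gaussian vector
    enters only through the products [s_i s_j / |s|^2], which are bounded and whose means follow
    from symmetry.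

    The estimate is proved on every event of the history at time [t] on which the error is small. An
    event defined by [eps_t] belongs to this history, so conditioning on [eps_t] alone requires no
    further argument about the law of [U_t]. *)

Section SquaredNorm.

(** * Squared Frobenius norms and inner products, written as traces *)

Context {R : realFieldType}.

Definition sqn m n (A : 'M[R]_(m, n)) : R := \tr (A^T *m A).

Definition mxdot m n (A B : 'M[R]_(m, n)) : R := \tr (A^T *m B).

Lemma mxdotE m n (A B : 'M[R]_(m, n)) :
  mxdot A B = \sum_i \sum_j A i j * B i j.
Proof.
rewrite /mxdot /mxtrace exchange_big /=; apply: eq_bigr => j _.
by rewrite mxE; apply: eq_bigr => i _; rewrite mxE.
Qed.

Lemma sqnE m n (A : 'M[R]_(m, n)) : sqn A = \sum_i \sum_j A i j ^+ 2.
Proof. exact: mxdotE. Qed.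

Lemma sqn_ge0 m n (A : 'M[R]_(m, n)) : 0 <= sqn A.
Proof.
by rewrite sqnE; apply: sumr_ge0 => i _; apply: sumr_ge0 => j _; apply: sqr_ge0.
Qed.

Lemma sqn0 m n : sqn (0 : 'M[R]_(m, n)) = 0.
Proof. by rewrite /sqn mulmx0 mxtrace0. Qed.

Lemma sqn_eq0 m n (A : 'M[R]_(m, n)) : (sqn A == 0) = (A == 0).
Proof.
apply/eqP/eqP => [|->]; last exact: sqn0.
rewrite sqnE => /eqP; rewrite psumr_eq0; last first.
  by move=> i _; apply: sumr_ge0 => j _; apply: sqr_ge0.
move=> /allP A0; apply/matrixP => i j; rewrite mxE.
have /implyP/(_ isT) := A0 i (mem_index_enum i).
rewrite psumr_eq0; last by move=> k _; apply: sqr_ge0.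
by move=> /allP/(_ j (mem_index_enum j)) /implyP/(_ isT); rewrite sqrf_eq0 => /eqP.
Qed.

Lemma sqnT m n (A : 'M[R]_(m, n)) : sqn A^T = sqn A.
Proof. by rewrite /sqn trmxK mxtrace_mulC. Qed.

Lemma mxdotC m n (A B : 'M[R]_(m, n)) : mxdot A B = mxdot B A.
Proof. by rewrite /mxdot -[LHS]mxtrace_tr trmx_mul trmxK. Qed.

Lemma mxdotDr m n (A B C : 'M[R]_(m, n)) : mxdot A (B + C) = mxdot A B + mxdot A C.
Proof. by rewrite /mxdot mulmxDr mxtraceD. Qed.

Lemma mxdotBr m n (A B C : 'M[R]_(m, n)) : mxdot A (B - C) = mxdot A B - mxdot A C.
Proof. by rewrite /mxdot mulmxBr raddfB. Qed.

Lemma mxdotZr m n a (A B : 'M[R]_(m, n)) : mxdot A (a *: B) = a * mxdot A B.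
Proof. by rewrite /mxdot -scalemxAr mxtraceZ. Qed.

Lemma mxdotMl m n p (A : 'M[R]_(m, n)) (B : 'M[R]_(n, p)) (C : 'M[R]_(m, p)) :
  mxdot (A *m B) C = mxdot B (A^T *m C).
Proof. by rewrite /mxdot trmx_mul mulmxA. Qed.

Lemma sqnD m n (A B : 'M[R]_(m, n)) :
  sqn (A + B) = sqn A + 2 * mxdot A B + sqn B.
Proof.
rewrite -[LHS]/(mxdot _ _) mxdotDr ![mxdot (A + B) _]mxdotC !mxdotDr.
by rewrite [mxdot B A]mxdotC /sqn -!/(mxdot _ _); ring.
Qed.

Lemma sqnZ m n a (A : 'M[R]_(m, n)) : sqn (a *: A) = a ^+ 2 * sqn A.
Proof. by rewrite -[LHS]/(mxdot _ _) mxdotZr mxdotC mxdotZr mulrA. Qed.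

Lemma sqnN m n (A : 'M[R]_(m, n)) : sqn (- A) = sqn A.
Proof. by rewrite -scaleN1r sqnZ; ring. Qed.

Lemma sqnB m n (A B : 'M[R]_(m, n)) :
  sqn (A - B) = sqn A - 2 * mxdot A B + sqn B.
Proof. by rewrite sqnD sqnN -scaleN1r mxdotZr; ring. Qed.

Lemma mxdot_le m n (A B : 'M[R]_(m, n)) : 2 * mxdot A B <= sqn A + sqn B.
Proof. by have := sqn_ge0 (A - B); rewrite sqnB; lra. Qed.

Lemma sqnB_le m n (A B : 'M[R]_(m, n)) : sqn (A - B) <= 2 * sqn A + 2 * sqn B.
Proof. by have := sqn_ge0 (A + B); rewrite sqnB sqnD; lra. Qed.

Lemma sqnD_le m n (A B : 'M[R]_(m, n)) : sqn (A + B) <= 2 * sqn A + 2 * sqn B.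
Proof. by have := sqn_ge0 (A - B); rewrite sqnB sqnD; lra. Qed.

Lemma mxdot_CS m n (A B : 'M[R]_(m, n)) : mxdot A B ^+ 2 <= sqn A * sqn B.
Proof.
have [B0|B0] := eqVneq (sqn B) 0.
  move/eqP: B0; rewrite sqn_eq0 => /eqP ->.
  by rewrite sqn0 /mxdot mulmx0 mxtrace0 expr0n mulr0.
have Bgt0 : 0 < sqn B by rewrite lt0r B0 sqn_ge0.
have := sqn_ge0 (sqn B *: A - mxdot A B *: B).
rewrite sqnB !sqnZ mxdotZr [mxdot (_ *: _) _]mxdotC mxdotZr [mxdot B A]mxdotC => h.
by rewrite -subr_ge0 -(pmulr_rge0 _ Bgt0); lra.
Qed.

Lemma mulmxE_dot m n p (A : 'M[R]_(m, n)) (B : 'M[R]_(n, p)) i j :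
  (A *m B) i j = mxdot (row i A)^T (col j B).
Proof. by rewrite mxE mxdotE; apply: eq_bigr => k _; rewrite big_ord1 !mxE. Qed.

Lemma sqn_rows m n (A : 'M[R]_(m, n)) : sqn A = \sum_i sqn (row i A).
Proof.
rewrite sqnE; apply: eq_bigr => i _; rewrite sqnE big_ord1.
by apply: eq_bigr => j _; rewrite mxE.
Qed.

Lemma sqn_cols m n (A : 'M[R]_(m, n)) : sqn A = \sum_j sqn (col j A).
Proof.
by rewrite -sqnT sqn_rows; apply: eq_bigr => i _; rewrite -sqnT tr_row trmxK.
Qed.

Lemma trmxM_outer m n p (A : 'M[R]_(m, n)) (B : 'M[R]_(m, p)) :
  A^T *m B = \sum_i (row i A)^T *m row i B.
Proof.
apply/matrixP => a b; rewrite summxE mxE.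
by apply: eq_bigr => i _; rewrite [RHS]mxE big_ord1 !mxE.
Qed.

(** Cauchy-Schwarz on each entry. This inequality stands in for operator norm bounds throughout. *)
Lemma sqnM m n p (A : 'M[R]_(m, n)) (B : 'M[R]_(n, p)) :
  sqn (A *m B) <= sqn A * sqn B.
Proof.
rewrite [sqn (A *m B)]sqnE (sqn_rows A) (sqn_cols B) mulr_suml.
apply: ler_sum => i _; rewrite mulr_sumr; apply: ler_sum => j _.
by rewrite mulmxE_dot (le_trans (mxdot_CS _ _))// sqnT.
Qed.

Lemma sqn_scalar1 n : sqn (1%:M : 'M[R]_n) = n%:R.
Proof. by rewrite /sqn trmx1 mulmx1 mxtrace1. Qed.

Lemma sqn_isom m n p (U : 'M[R]_(m, n)) (A : 'M[R]_(n, p)) :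
  U^T *m U = 1%:M -> sqn (U *m A) = sqn A.
Proof. by move=> UU; rewrite /sqn -!/(mxdot _ _) mxdotMl mulmxA UU mul1mx. Qed.

(* Pythagoras: [U U^T] is the orthogonal projection on the range of [U]. *)
Lemma sqn_proj_compl m n p (U : 'M[R]_(m, n)) (A : 'M[R]_(m, p)) :
  U^T *m U = 1%:M -> sqn (A - U *m U^T *m A) = sqn A - sqn (U^T *m A).
Proof.
move=> UU; rewrite sqnB -!mulmxA sqn_isom// mxdotC mxdotMl.
by rewrite -/(sqn _); ring.
Qed.

Lemma sqn_trM_le m n p (U : 'M[R]_(m, n)) (A : 'M[R]_(m, p)) :
  U^T *m U = 1%:M -> sqn (U^T *m A) <= sqn A.
Proof. by move=> UU; have := sqn_ge0 (A - U *m U^T *m A); rewrite sqn_proj_compl// subr_ge0. Qed.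

Lemma sqn_rank1 m n (a : 'cV[R]_m) (b : 'rV[R]_n) : sqn (a *m b) = sqn a * sqn b.
Proof.
rewrite sqnE (sqnE a) mulr_suml; apply: eq_bigr => i _.
rewrite big_ord1 (sqnE b) big_ord1 mulr_sumr; apply: eq_bigr => j _.
by rewrite mxE big_ord1; ring.
Qed.

End SquaredNorm.

(** * A mean value inequality for odd powers of symmetric matrices *)

Section TraceInequality.
Context {R : realFieldType}.

(** Once an increment is nonnegative so are all later ones: at any index the sequence either climbs
    on to [g m] or has only descended from [g 0]. *)
Lemma le_max_convex_seq (g : nat -> R) (m : nat) :
  (forall a, (a.+1 < m)%N -> 2 * g a.+1 <= g a + g a.+2) ->
  forall a, (a <= m)%N -> g a <= Num.max (g 0%N) (g m).
Proof.
move=> cvx.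
have incr a b : (a <= b)%N -> (b < m)%N -> g a <= g a.+1 -> g b <= g b.+1.
  elim: b => [|b ih]; first by rewrite leqn0 => /eqP ->.
  rewrite leq_eqVlt => /predU1P[->//|ab] bm gaa.
  by have := ih ab (ltnW bm) gaa; have := cvx _ bm; lra.
have up a c : (a + c <= m)%N -> g a <= g a.+1 -> g a <= g (a + c)%N.
  elim: c => [|c ih]; first by rewrite addn0.
  rewrite addnS => acm gaa; rewrite (le_trans (ih (ltnW acm) gaa))//.
  by apply: (incr a) => //; rewrite leq_addr.
elim=> [_|a ih am]; first by rewrite le_max lexx.
rewrite le_max; have [gaa|/ltW gaa] := leP (g a) (g a.+1).
  move: am; rewrite leq_eqVlt => /predU1P[->|am]; first by rewrite lexx orbT.
  have := up a.+1 (m - a.+1)%N; rewrite subnKC ?(ltnW am)//.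
  by move=> ->//; [rewrite orbT | apply: (incr a)].
have := ih (ltnW am); rewrite le_max => /orP[h|h]; first by rewrite (le_trans gaa h).
by rewrite (le_trans gaa h) orbT.
Qed.

Variable d : nat.
Implicit Types D X Y : 'M[R]_d.

Lemma trmx_exp X q : X^T = X -> (X ^+ q)^T = X ^+ q.
Proof.
move=> sX; elim: q => [|q ih]; first by rewrite expr0 trmx1.
by rewrite exprS trmx_mul ih sX mulmxE -exprSr exprS.
Qed.

Lemma mxdot_pow D X Y a b a' b' : D^T = D -> X^T = X -> Y^T = Y ->
  mxdot (X ^+ a * D * Y ^+ b) (X ^+ a' * D * Y ^+ b') =
  \tr (D * X ^+ (a + a') * D * Y ^+ (b' + b)).
Proof.
move=> sD sX sY.
rewrite /mxdot !trmx_mul !trmx_exp// sD -!mulmxE -!mulmxA mxtrace_mulC.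
by rewrite !mulmxE !mulrA exprD -!mulrA -exprD !mulrA exprD !mulrA.
Qed.

(* The even powers form a midpoint-convex sequence, by Cauchy-Schwarz. *)
Lemma trace_pow_le D X Y m q : D^T = D -> X^T = X -> Y^T = Y ->
  (q <= m.*2)%N ->
  \tr (D * X ^+ q * D * Y ^+ (m.*2 - q)) <= sqn (D * Y ^+ m) + sqn (X ^+ m * D).
Proof.
move=> sD sX sY qm.
pose g a := sqn (X ^+ a * D * Y ^+ (m - a)).
have tr_le a b : (a <= m)%N -> (b <= m)%N ->
    2 * \tr (D * X ^+ (a + b) * D * Y ^+ (m.*2 - (a + b))) <= g a + g b.
  move=> am bm; have -> : (m.*2 - (a + b) = (m - b) + (m - a))%N by lia.
  by rewrite -mxdot_pow// mxdot_le.
have gE a : (a <= m)%N -> g a = \tr (D * X ^+ (a + a) * D * Y ^+ (m.*2 - (a + a))).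
  move=> am; have -> : (m.*2 - (a + a) = (m - a) + (m - a))%N by lia.
  by rewrite -mxdot_pow.
have cvx b : (b.+1 < m)%N -> 2 * g b.+1 <= g b + g b.+2.
  move=> bm; rewrite (gE b.+1); last by lia.
  have -> : (b.+1 + b.+1 = b + b.+2)%N by lia.
  by apply: tr_le; lia.
have g_le a : (a <= m)%N -> g a <= g 0%N + g m.
  move=> am; have := le_max_convex_seq cvx am.
  have g0 : 0 <= g 0%N := sqn_ge0 _.
  have gm : 0 <= g m := sqn_ge0 _.
  by rewrite le_max => /orP[] h; lra.
have -> : sqn (D * Y ^+ m) + sqn (X ^+ m * D) = g 0%N + g m.
  by rewrite /g subn0 subnn !expr0 mul1r mulr1.
(* An odd [q] gives no value of [g]; split into its lower and upper halves, it bounds the trace by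
   the mean of two values. *)
have := tr_le q./2 (q - q./2)%N; rewrite subnKC; last by lia.
have h1 : (q./2 <= m)%N by lia.
have h2 : (q - q./2 <= m)%N by lia.
by move=> /(_ h1 h2); have := g_le _ h1; have := g_le _ h2; lra.
Qed.

Lemma sub_expr_telescope X Y N :
  X ^+ N - Y ^+ N = \sum_(q < N) X ^+ q * (X - Y) * Y ^+ (N.-1 - q).
Proof.
elim: N => [|N ih]; first by rewrite big_ord0 !expr0 subrr.
rewrite big_ord_recl expr0 mul1r /= subn0.
have -> : X ^+ N.+1 - Y ^+ N.+1 = (X - Y) * Y ^+ N + X * (X ^+ N - Y ^+ N).
  by rewrite mulrBl mulrBr -!exprS [RHS]addrC addrA subrK.
rewrite ih mulr_sumr; congr (_ + _); apply: eq_bigr => q _ /=.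
rewrite !mulrA -exprS /bump /=; congr (_ * _ * Y ^+ _); lia.
Qed.

(** [X] and [Y] need not commute: the difference of powers telescopes into [2m+1] terms, and
    [trace_pow_le] bounds each by the same two extreme ones, whatever its exponent. *)
Lemma trace_diff_pow_le X Y m : X^T = X -> Y^T = Y ->
  \tr ((X - Y) * (X ^+ m.*2.+1 - Y ^+ m.*2.+1)) <=
  (m.*2.+1)%:R * (sqn ((X - Y) * X ^+ m) + sqn ((X - Y) * Y ^+ m)).
Proof.
move=> sX sY; have sD : (X - Y)^T = X - Y by rewrite linearB /= sX sY.
rewrite sub_expr_telescope mulr_sumr raddf_sum /=.
rewrite -[X in _ <= X%:R * _]card_ord -sum1_card natr_sum mulr_suml.
apply: ler_sum => q _; rewrite mul1r !mulrA.
have qm : (q <= m.*2)%N by have := ltn_ord q; lia.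
apply: le_trans (trace_pow_le sD sX sY qm) _.
by rewrite addrC lerD2r -sqnT trmx_mul trmx_exp// sD.
Qed.

End TraceInequality.

(** * Moments under a sampling weight invariant under swaps *)

Definition swap n (i j : 'I_n) (S : {set 'I_n}) : {set 'I_n} := tperm i j @: S.

Section SwapInvariantSampling.
Context {R : realFieldType}.
Variables (n k : nat) (phi : {set 'I_n} -> R).
Hypothesis phi_ge0 : forall S, 0 <= phi S.
Hypothesis phi_swap : forall i j S, phi (swap i j S) = phi S.
Hypothesis phi_card : forall S, phi S != 0 -> #|S| = k.

Local Notation Phi := (\sum_S phi S).
Local Notation kr := (k%:R : R).
Local Notation nr := (n%:R : R).

Lemma swapK (i j : 'I_n) (S : {set 'I_n}) : swap i j (swap i j S) = S.
Proof. by rewrite /swap -imset_comp (eq_imset (g := id)) ?imset_id// => x /=; rewrite tpermK. Qed.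

Lemma mem_swapl (i j : 'I_n) (S : {set 'I_n}) : (i \in swap i j S) = (j \in S).
Proof. by rewrite /swap -[X in X \in _](tpermR i j) mem_imset//; apply: perm_inj. Qed.

Lemma mem_swapr (i j : 'I_n) (S : {set 'I_n}) : (j \in swap i j S) = (i \in S).
Proof. by rewrite /swap -[X in X \in _](tpermL i j) mem_imset//; apply: perm_inj. Qed.

(** Relabelling [S] as its swap preserves the weight and exchanges the roles of the sampled [i] and
    the unsampled [j]. *)
Lemma exchange_sampling (F : {set 'I_n} -> {set 'I_n} -> R) :
  \sum_S phi S * (\sum_(i in S) \sum_(j | j \notin S) F S (swap i j S)) =
  \sum_S phi S * (\sum_(i in S) \sum_(j | j \notin S) F (swap i j S) S).
Proof.
have expand G : \sum_S phi S * (\sum_(i in S) \sum_(j | j \notin S) G i j S) =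
    \sum_i \sum_j \sum_(S : {set 'I_n} | (i \in S) && (j \notin S)) phi S * G i j S.
  under eq_bigr do rewrite mulr_sumr.
  rewrite (exchange_big_dep xpredT)//=; apply: eq_bigr => i _.
  under eq_bigr do rewrite mulr_sumr.
  by rewrite (exchange_big_dep xpredT)//=.
rewrite (expand (fun i j S => F S (swap i j S))).
rewrite (expand (fun i j S => F (swap i j S) S)) exchange_big /=.
apply: eq_bigr => i _; apply: eq_bigr => j _.
rewrite (reindex_inj (h := fun S => swap j i S)) /=; last first.
  by move=> S S' /(congr1 (fun S => swap j i S)); rewrite !swapK.
apply: eq_big => [S|S _]; first by rewrite mem_swapl mem_swapr.
by rewrite phi_swap swapK /swap tpermC.
Qed.

Lemma sum_pairs (V : zmodType) (a b : 'I_n -> V) (S : {set 'I_n}) :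
  \sum_(i in S) \sum_(j | j \notin S) (a i + b j) =
  (\sum_(i in S) a i) *+ (n - #|S|) + (\sum_(j | j \notin S) b j) *+ #|S|.
Proof.
have nS : (#|[pred j | j \notin S]| = n - #|S|)%N.
  have -> : #|[pred j | j \notin S]| = #|[predC S]| by apply: eq_card => j; rewrite !inE.
  by have := cardC S; rewrite card_ord; lia.
under eq_bigr do rewrite big_split /=.
rewrite big_split /= -sumrMnl; congr (_ + _); last by rewrite sumr_const.
by apply: eq_bigr => i _; rewrite sumr_const -nS.
Qed.

Lemma sum_notin (V : zmodType) (a : 'I_n -> V) (S : {set 'I_n}) :
  \sum_(j | j \notin S) a j = \sum_j a j - \sum_(j in S) a j.
Proof. by rewrite [\sum_j a j](bigID (mem S)) /= [X in X - _]addrC addrK. Qed.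

Lemma phi_cardE (f g : {set 'I_n} -> R) :
  (forall S : {set 'I_n}, #|S| = k -> f S = g S) ->
  \sum_S phi S * f S = \sum_S phi S * g S.
Proof.
move=> fg; apply: eq_bigr => S _; have [->|/phi_card/fg ->//] := eqVneq (phi S) 0.
by rewrite !mul0r.
Qed.

Lemma phi_card_le (f g : {set 'I_n} -> R) :
  (forall S : {set 'I_n}, #|S| = k -> f S <= g S) ->
  \sum_S phi S * f S <= \sum_S phi S * g S.
Proof.
move=> fg; apply: ler_sum => S _; have [->|/phi_card/fg h] := eqVneq (phi S) 0.
  by rewrite !mul0r.
by rewrite ler_wpM2l.
Qed.

Hypothesis n_gt0 : (0 < n)%N.

(** By swapping, all indices have the same inclusion weight, and these weights add up to
    [k * Phi]. *)
Lemma first_moment (b : 'I_n -> R) :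
  \sum_S phi S * (\sum_(i in S) b i) = kr / nr * Phi * \sum_i b i.
Proof.
pose w (i : 'I_n) := \sum_(S : {set 'I_n} | i \in S) phi S.
have wE i j : w i = w j.
  rewrite /w (reindex_inj (h := fun S => swap i j S)) /=; last first.
    by move=> S S' /(congr1 (fun S => swap i j S)); rewrite !swapK.
  by apply: eq_big => [S|S _]; rewrite ?mem_swapl ?phi_swap.
have expand (c : 'I_n -> R) :
    \sum_S phi S * (\sum_(i in S) c i) = \sum_i w i * c i.
  under eq_bigr do rewrite mulr_sumr.
  rewrite (exchange_big_dep xpredT)//=.
  by apply: eq_bigr => i _; rewrite mulr_suml.
have sumw : nr * w (Ordinal n_gt0) = kr * Phi.
  transitivity (\sum_i w i * 1).
    under eq_bigr do rewrite mulr1 (wE _ (Ordinal n_gt0)).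
    by rewrite sumr_const card_ord mulr_natl.
  rewrite -expand mulrC mulr_suml; apply: phi_cardE => S <-.
  by rewrite sumr_const.
have n0 : nr != 0 by rewrite pnatr_eq0 -lt0n.
rewrite expand; under eq_bigr do rewrite (wE _ (Ordinal n_gt0)).
rewrite -mulr_sumr; congr (_ * _); apply: (mulfI n0); rewrite sumw.
by field.
Qed.

Section CenteredSum.
Variables (p q : nat) (a : 'I_n -> 'M[R]_(p, q)).

Definition centered_sum (S : {set 'I_n}) : 'M[R]_(p, q) :=
  \sum_(i in S) a i - (kr / nr) *: \sum_i a i.

Lemma centered_sum_swap (S : {set 'I_n}) (i j : 'I_n) : i \in S -> j \notin S ->
  centered_sum S - centered_sum (swap i j S) = a i - a j.
Proof.
move=> iS jS; rewrite /centered_sum opprB subrKA.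
rewrite /swap big_imset /=; last by move=> x y _ _; apply: perm_inj.
rewrite (bigD1 i)//= [X in _ - X](bigD1 i)//= tpermL.
rewrite [X in _ + X - _](eq_bigr (fun x => a (tperm i j x))); last first.
  move=> x /andP[xS xi]; rewrite tpermD// eq_sym//.
  by apply: contraNneq jS => <-.
by rewrite opprD addrACA subrr addr0.
Qed.

(** The linear regression property of a Stein pair: the differences [a i - a j] only involve the
    sums inside and outside [S], so the deviation itself is recovered, [n] times. *)
Lemma sum_centered_sum_swap (S : {set 'I_n}) : #|S| = k ->
  \sum_(i in S) \sum_(j | j \notin S) (centered_sum S - centered_sum (swap i j S))
  = nr *: centered_sum S.
Proof.
move=> Sk; transitivity (\sum_(i in S) \sum_(j | j \notin S) (a i + - a j)).
  by apply: eq_bigr => i iS; apply: eq_bigr => j jS; rewrite centered_sum_swap.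
have kn : (k <= n)%N by rewrite -Sk -[n in (_ <= n)%N]card_ord max_card.
have n0 : nr != 0 by rewrite pnatr_eq0 -lt0n.
rewrite sum_pairs sumrN sum_notin Sk -[X in X + _]scaler_nat.
rewrite -[X in _ + X]scaler_nat natrB// /centered_sum.
rewrite scalerBl scalerN !scalerBr scalerA [nr * _]mulrC divfK//.
by rewrite opprB addrA subrK.
Qed.

Lemma second_moment_le : \sum_i a i = 0 ->
  \sum_S phi S * sqn (\sum_(i in S) a i) <=
  2 * (kr / nr) * Phi * \sum_i sqn (a i).
Proof.
move=> a0; have csE S : centered_sum S = \sum_(i in S) a i.
  by rewrite /centered_sum a0 scaler0 subr0.
have nr0 : 0 < nr by rewrite ltr0n.
rewrite -(ler_pM2l nr0).
pose F S S' := mxdot (centered_sum S) (centered_sum S - centered_sum S').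
have step1 : nr * \sum_S phi S * sqn (\sum_(i in S) a i) =
    \sum_S phi S * (\sum_(i in S) \sum_(j | j \notin S) F S (swap i j S)).
  rewrite mulr_sumr; under eq_bigr do rewrite mulrCA.
  apply: phi_cardE => S Sk; rewrite -csE /F.
  rewrite [RHS](_ : _ = mxdot (centered_sum S) (nr *: centered_sum S)).
    by rewrite mxdotZr.
  rewrite -sum_centered_sum_swap// /mxdot mulmx_sumr raddf_sum /=.
  by apply: eq_bigr => i _; rewrite mulmx_sumr raddf_sum.
(* Adding the mirror image of [F] turns the product into a square, and only the single difference
   [a i - a j] remains in it. *)
have step2 : 2 * (nr * \sum_S phi S * sqn (\sum_(i in S) a i)) =
    \sum_S phi S * (\sum_(i in S) \sum_(j | j \notin S) sqn (a i - a j)).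
  rewrite mulr_natl mulr2n {1}step1 exchange_sampling step1 -big_split /=.
  apply: eq_bigr => S _; rewrite -mulrDr; congr (_ * _).
  rewrite -big_split /=; apply: eq_bigr => i iS.
  rewrite -big_split /=; apply: eq_bigr => j jS.
  rewrite -(centered_sum_swap iS jS) /F.
  move: (centered_sum S) (centered_sum (swap i j S)) => X X'.
  by rewrite sqnB !mxdotBr [mxdot X' X]mxdotC -!/(sqn _); ring.
rewrite -(ler_pM2l (ltr0Sn R 1)) step2.
pose b i := 2 * sqn (a i).
have b_ge0 i : 0 <= b i by rewrite mulr_ge0 ?sqn_ge0.
have step3 : \sum_S phi S * (\sum_(i in S) \sum_(j | j \notin S) sqn (a i - a j)) <=
    \sum_S phi S * (nr * \sum_(i in S) b i + kr * \sum_j b j).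
  apply: phi_card_le => S Sk.
  apply: le_trans (_ : \sum_(i in S) \sum_(j | j \notin S) (b i + b j) <= _).
    by apply: ler_sum => i _; apply: ler_sum => j _; apply: sqnB_le.
  rewrite sum_pairs Sk -[X in X + _ <= _]mulr_natl -[X in _ + X <= _]mulr_natl.
  apply: lerD.
    by apply: ler_wpM2r; [apply: sumr_ge0|rewrite ler_nat leq_subr].
  by apply: ler_wpM2l; rewrite // sum_notin lerBlDr lerDl sumr_ge0.
apply: le_trans step3 _.
under eq_bigr do rewrite mulrDr mulrCA.
rewrite big_split /= -mulr_sumr first_moment -mulr_suml /b -mulr_sumr.
have n0 : nr != 0 by rewrite gt_eqF.
by rewrite le_eqVlt; apply/orP; left; apply/eqP; field.
Qed.

End CenteredSum.
End SwapInvariantSampling.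

(** * Concentration of the sampled Gram matrix *)

Section GramConcentration.
Context {R : realFieldType}.
Variables (n k d : nat) (phi : {set 'I_n} -> R).
Hypothesis phi_ge0 : forall S, 0 <= phi S.
Hypothesis phi_swap : forall i j S, phi (swap i j S) = phi S.
Hypothesis phi_card : forall S, phi S != 0 -> #|S| = k.
Hypothesis n_gt0 : (0 < n)%N.
Hypothesis k_gt0 : (0 < k)%N.
Variables (u : 'M[R]_(n, d)) (L : R).
Hypothesis uu : u^T *m u = 1%:M.
Hypothesis uL : forall i, sqn (row i u) <= L.

Local Notation Phi := (\sum_S phi S).
Local Notation kr := (k%:R : R).
Local Notation nr := (n%:R : R).

Let outer (i : 'I_n) : 'M[R]_d := (row i u)^T *m row i u.

Definition gram_dev (S : {set 'I_n}) : 'M[R]_d := centered_sum k outer S.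

Let sum_outer : \sum_i outer i = 1%:M.
Proof.
by rewrite -uu trmxM_outer.
Qed.

Let tr_outer i : (outer i)^T = outer i.
Proof. by rewrite /outer trmx_mul trmxK. Qed.

Let tr_dev S : (gram_dev S)^T = gram_dev S.
Proof.
rewrite /gram_dev /centered_sum sum_outer linearB linearZ /= trmx1 linear_sum.
by congr (_ - _); apply: eq_bigr => i _; apply: tr_outer.
Qed.

Let L_ge0 : 0 <= L.
Proof. exact: le_trans (sqn_ge0 _) (uL (Ordinal n_gt0)). Qed.

Let nr_gt0 : 0 < nr. Proof. by rewrite ltr0n. Qed.
Let kr_gt0 : 0 < kr. Proof. by rewrite ltr0n. Qed.

Let sqn_diff_outer_le (Z : 'M[R]_d) i j :
  sqn ((outer i - outer j) *m Z) <=
  2 * L * sqn (row i u *m Z) + 2 * L * sqn (row j u *m Z).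
Proof.
have h l : sqn (outer l *m Z) <= L * sqn (row l u *m Z).
  by rewrite -mulmxA sqn_rank1 sqnT ler_wpM2r ?sqn_ge0.
rewrite mulmxBl (le_trans (sqnB_le _ _))// -!mulrA lerD// ler_wpM2l//.
Qed.

(** The sampled Gram matrix is [X + k/n], so the sum is [<X^m, X^(m+1)> + (k/n) |X^m|^2]. The
    product is split with weights [n/(2k)] and [k/(2n)], which leaves the higher moment a
    coefficient that can be absorbed later. *)
Let sum_sqn_rows_in (S : {set 'I_n}) m : #|S| = k ->
  \sum_(i in S) sqn (row i u *m gram_dev S ^+ m) <=
  nr / (2 * kr) * sqn (gram_dev S ^+ m.+1) + 3 / 2 * (kr / nr) * sqn (gram_dev S ^+ m).
Proof.
move=> Sk; set X := gram_dev S.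
have -> : \sum_(i in S) sqn (row i u *m X ^+ m) =
      mxdot (X ^+ m) ((\sum_(i in S) outer i) *m X ^+ m).
  rewrite mulmx_suml /mxdot mulmx_sumr raddf_sum /=; apply: eq_bigr => i _.
  by rewrite /sqn trmx_mul /outer !mulmxA.
have -> : \sum_(i in S) outer i = X + (kr / nr) *: 1%:M.
  by rewrite /X /gram_dev /centered_sum sum_outer subrK.
rewrite mulmxDl -scalemxAl mul1mx mxdotDr mxdotZr mulmxE -exprS -/(sqn _).
have := sqn_ge0 (X ^+ m.+1 - (kr / nr) *: X ^+ m).
rewrite sqnB sqnZ mxdotZr mxdotC => h.
have kn0 : 0 < kr / nr by rewrite divr_gt0.
have {}h : mxdot (X ^+ m) (X ^+ m.+1) <=
    nr / (2 * kr) * sqn (X ^+ m.+1) + 1 / 2 * (kr / nr) * sqn (X ^+ m).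
  rewrite -(ler_pM2l kn0) -subr_ge0.
  have -> : kr / nr * (nr / (2 * kr) * sqn (X ^+ m.+1) + 1 / 2 * (kr / nr) * sqn (X ^+ m)) =
      1 / 2 * sqn (X ^+ m.+1) + 1 / 2 * (kr / nr) ^+ 2 * sqn (X ^+ m).
    by field; rewrite !gt_eqF.
  by lra.
by lra.
Qed.

(* The moments of the deviation of the sampled Gram matrix are compared by an
   exchangeable pair: one sampled index is swapped with an unsampled one. *)
Let moment_step m : L * nr * (m.*2.+1)%:R * 5 <= kr ->
  \sum_S phi S * sqn (gram_dev S ^+ m.+1) <=
  25 / 4 * (L * kr / nr) * (m.*2.+1)%:R * \sum_S phi S * sqn (gram_dev S ^+ m).
Proof.
move=> small; set M := (m.*2.+1)%:R : R; have M_ge0 : 0 <= M by rewrite ler0n.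
set s' := \sum_S _ * sqn (_ ^+ m.+1); set s := \sum_S _ * sqn (_ ^+ m).
pose F S S' := \tr ((gram_dev S - gram_dev S') *m gram_dev S ^+ m.*2.+1).
pose D S S' := sqn ((gram_dev S - gram_dev S') *m gram_dev S ^+ m).
have step1 : nr * s' =
    \sum_S phi S * (\sum_(i in S) \sum_(j | j \notin S) F S (swap i j S)).
  rewrite mulr_sumr; under eq_bigr do rewrite mulrCA.
  apply: (phi_cardE phi_card) => S Sk.
  have -> : sqn (gram_dev S ^+ m.+1) = \tr (gram_dev S *m gram_dev S ^+ m.*2.+1).
    rewrite /sqn trmx_exp// !mulmxE -exprD -exprS; congr (\tr (_ ^+ _)); lia.
  rewrite -mxtraceZ scalemxAl -(sum_centered_sum_swap n_gt0 outer Sk).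
  rewrite mulmx_suml raddf_sum /=; apply: eq_bigr => i _.
  by rewrite mulmx_suml raddf_sum.
(* Symmetrizing over the pair produces the trace bounded by [trace_diff_pow_le]; the two norms in
   that bound are mirror images of each other, hence the factor 2. *)
have step2 : 2 * (nr * s') <= 2 * M *
    \sum_S phi S * (\sum_(i in S) \sum_(j | j \notin S) D S (swap i j S)).
  have -> : 2 * M * (\sum_S phi S * (\sum_(i in S) \sum_(j | j \notin S) D S (swap i j S))) =
    \sum_S phi S * (\sum_(i in S) \sum_(j | j \notin S)
      M * (D S (swap i j S) + D (swap i j S) S)).
    rewrite [2 * M]mulrC -mulrA mulr_natl mulr2n {1}exchange_sampling//.
    rewrite -big_split mulr_sumr /=; apply: eq_bigr => S _.
    rewrite -mulrDr mulrCA; congr (_ * _).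
    rewrite -big_split mulr_sumr /=; apply: eq_bigr => i _.
    rewrite -big_split mulr_sumr /=; apply: eq_bigr => j _.
    by rewrite addrC.
  rewrite mulr_natl mulr2n {1}step1 exchange_sampling// step1 -big_split /=.
  apply: ler_sum => S _; rewrite -mulrDr ler_wpM2l//.
  rewrite -big_split; apply: ler_sum => i _; rewrite -big_split; apply: ler_sum => j _ /=.
  rewrite /F /D; move: (gram_dev S) (gram_dev (swap i j S)) (tr_dev S) (tr_dev (swap i j S)).

  move=> X X' sX sX'; have := trace_diff_pow_le m sX sX'.
  move=> h; rewrite [X in X <= _]addrC; move: h.
  have -> : \tr ((X - X') *m X ^+ m.*2.+1) + \tr ((X' - X) *m X' ^+ m.*2.+1) =
      \tr ((X - X') * (X ^+ m.*2.+1 - X' ^+ m.*2.+1)).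
    by rewrite mulrBr raddfB /= -(opprB X X') mulNmx raddfN.
  by rewrite -(opprB X X') mulNmx sqnN.
have step3 : \sum_S phi S * (\sum_(i in S) \sum_(j | j \notin S) D S (swap i j S)) <=
    \sum_S phi S * (nr * (nr / (2 * kr) * (2 * L) * sqn (gram_dev S ^+ m.+1)) +
                    5 / 2 * kr * (2 * L) * sqn (gram_dev S ^+ m)).
  apply: (phi_card_le phi_ge0 phi_card) => S Sk.
  pose b i := 2 * L * sqn (row i u *m gram_dev S ^+ m).
  have b_ge0 i : 0 <= b i by rewrite !mulr_ge0 ?sqn_ge0.
  apply: le_trans (_ : \sum_(i in S) \sum_(j | j \notin S) (b i + b j) <= _).
    apply: ler_sum => i iS; apply: ler_sum => j jS.
    by rewrite /D /gram_dev centered_sum_swap// sqn_diff_outer_le.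
  have sumb : \sum_i b i = 2 * L * sqn (gram_dev S ^+ m).
    rewrite -mulr_sumr; congr (_ * _); rewrite -[in RHS](sqn_isom _ uu) sqn_rows.
    by apply: eq_bigr => i _; rewrite row_mul.
  have sumbS := sum_sqn_rows_in m Sk.
  rewrite sum_pairs Sk -[X in X + _ <= _]mulr_natl -[X in _ + X <= _]mulr_natl.
  rewrite sum_notin sumb /b -mulr_sumr.
  set B := \sum_(i in S) _ in sumbS *.
  have B_ge0 : 0 <= B by apply: sumr_ge0 => i _; apply: sqn_ge0.
  have LB : 2 * L * B <= 2 * L * (nr / (2 * kr) * sqn (gram_dev S ^+ m.+1) +
      3 / 2 * (kr / nr) * sqn (gram_dev S ^+ m)) by rewrite ler_wpM2l// mulr_ge0.
  have LB0 : 0 <= 2 * L * B by rewrite !mulr_ge0.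
  have kLB0 : 0 <= kr * (2 * L * B) by rewrite mulr_ge0// ltW.
  have nk : ((n - k)%:R : R) <= nr by rewrite ler_nat leq_subr.
  have h1 := ler_wpM2r LB0 nk.
  have h2 := ler_wpM2l (ltW nr_gt0) LB.
  have h3 : nr * (2 * L * (3 / 2 * (kr / nr) * sqn (gram_dev S ^+ m))) =
      3 / 2 * kr * (2 * L) * sqn (gram_dev S ^+ m) by field; rewrite gt_eqF.
  rewrite mulrDr in h2; rewrite mulrDr h3 in h2.
  by lra.
set G := \sum_(S : {set 'I_n}) _ in step2; rewrite -/G in step3.
have {}step3 : G <= nr * (nr / (2 * kr) * (2 * L)) * s' + 5 / 2 * kr * (2 * L) * s.
  apply: le_trans step3 _; rewrite le_eqVlt; apply/orP; left; apply/eqP.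
  rewrite /s' /s !mulr_sumr -big_split /=; apply: eq_bigr => S _; ring.
have s'_ge0 : 0 <= s' by apply: sumr_ge0 => S _; rewrite mulr_ge0 ?sqn_ge0.
have G1 : nr * s' <= M * (nr * (nr / (2 * kr) * (2 * L)) * s' + 5 / 2 * kr * (2 * L) * s).
  by have := ler_wpM2l M_ge0 step3; lra.
(* The right-hand side contains [s'] again. The smallness assumption lets it be absorbed on the
   left, at the price of a factor 5/4. *)
have small' : M * (nr * (nr / (2 * kr) * (2 * L)) * s') <= nr / 5 * s'.
  rewrite mulrA ler_wpM2r//.
  have -> : M * (nr * (nr / (2 * kr) * (2 * L))) = nr / 5 * (L * nr * M * 5 / kr).
    by field; rewrite gt_eqF.
  apply: ler_piMr; first by rewrite divr_ge0 ?(ltW nr_gt0).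
  by rewrite ler_pdivrMr// mul1r.
rewrite -(ler_pM2l nr_gt0).
have -> : nr * (25 / 4 * (L * kr / nr) * M * s) = 5 / 4 * (M * (5 / 2 * kr * (2 * L) * s)).
  by field; rewrite gt_eqF.
by lra.
Qed.

(** Markov's inequality at order [2P]. Each step of the recursion is to gain a third of the squared
    threshold, which asks for [75 L n (2m+1) <= k]; as [2m+1 <= 2P], the constant is 150. *)
Lemma gram_dev_tail (P : nat) : 150 * L * nr * P%:R <= kr ->
  \sum_(S : {set 'I_n} | (kr / (2 * nr)) ^+ P.*2 < sqn (gram_dev S ^+ P)) phi S <=
  d%:R * 3^-1 ^+ P * Phi.
Proof.
move=> hP; pose c := (kr / (2 * nr)) ^+ 2.
have c_gt0 : 0 < c by rewrite exprn_gt0// divr_gt0// mulr_gt0.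
have moment m : (m <= P)%N ->
    \sum_S phi S * sqn (gram_dev S ^+ m) <= (c / 3) ^+ m * (d%:R * Phi).
  elim: m => [_|m ih mP].
    rewrite expr0 mul1r mulr_sumr; apply: ler_sum => S _.
    by rewrite expr0 sqn_scalar1 mulrC.
  have LnM : 150 * (L * nr * (m.*2.+1)%:R) <= 2 * kr.
    have -> : 150 * (L * nr * (m.*2.+1)%:R) = 150 * L * nr * (m.*2.+1)%:R by ring.
    apply: le_trans (_ : 150 * L * nr * (2 * P%:R) <= _); last by lra.
    rewrite ler_wpM2l ?mulr_ge0 ?(ltW nr_gt0)// -natrM ler_nat; lia.
  have LnM0 : 0 <= L * nr * (m.*2.+1)%:R by rewrite !mulr_ge0 ?(ltW nr_gt0).
  apply: le_trans (moment_step _) _; first by lra.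
  have C_ge0 : 0 <= 25 / 4 * (L * kr / nr) * (m.*2.+1)%:R.
    by rewrite !mulr_ge0 ?invr_ge0 ?(ltW nr_gt0) ?(ltW kr_gt0).
  apply: le_trans (ler_wpM2l C_ge0 (ih (ltnW mP))) _.
  rewrite exprS -[X in _ <= X]mulrA ler_wpM2r//.
    by rewrite mulr_ge0 ?exprn_ge0 ?divr_ge0 ?(ltW c_gt0)// mulr_ge0// sumr_ge0.
  have -> : 25 / 4 * (L * kr / nr) * (m.*2.+1)%:R =
      25 / 4 * (L * nr * (m.*2.+1)%:R) * (kr / nr ^+ 2) by field; rewrite gt_eqF.
  have -> : c / 3 = kr / 12 * (kr / nr ^+ 2) by rewrite /c; field; rewrite gt_eqF.
  apply: ler_wpM2r; last by lra.
  by rewrite divr_ge0 ?exprn_ge0 ?(ltW nr_gt0) ?(ltW kr_gt0).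
have cP_gt0 : 0 < c ^+ P by rewrite exprn_gt0.
rewrite -(ler_pM2l cP_gt0).
have -> : c ^+ P * (d%:R * 3^-1 ^+ P * Phi) = (c / 3) ^+ P * (d%:R * Phi).
  by rewrite [(c / 3) ^+ P]exprMn; ring.
apply: le_trans (moment P (leqnn P)).
rewrite mulr_sumr big_mkcond /=; apply: ler_sum => S _.
have -> : (kr / (2 * nr)) ^+ P.*2 = c ^+ P by rewrite -mul2n exprM.
case: ifPn => [h|_]; first by rewrite mulrC ler_wpM2l// ltW.
by rewrite mulr_ge0 ?sqn_ge0.
Qed.

End GramConcentration.

(** * Sampled rows and the spectral condition *)

Section SampledRows.
Context {R : realType}.

Lemma rows_in_trM n d e (S : {set 'I_n}) (A : 'M[R]_(n, d)) (B : 'M[R]_(n, e)) :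
  (rows_in S A)^T *m rows_in S B = \sum_(i in S) (row i A)^T *m row i B.
Proof.
apply/matrixP => a b; rewrite summxE mxE (big_enum_val (A := mem S)) /=.
by apply: eq_bigr => j _; rewrite [RHS]mxE big_ord1 !mxE.
Qed.

Lemma sqn_rows_in n d (S : {set 'I_n}) (A : 'M[R]_(n, d)) :
  sqn (rows_in S A) = \sum_(i in S) sqn (row i A).
Proof.
rewrite /sqn rows_in_trM raddf_sum /=; apply: eq_bigr => i _.
by rewrite /sqn.
Qed.

Lemma sqn_rows_in_le n d (S : {set 'I_n}) (A : 'M[R]_(n, d)) :
  sqn (rows_in S A) <= sqn A.
Proof.
rewrite sqn_rows_in sqn_rows [X in _ <= X](bigID (mem S)) /= lerDl.
by apply: sumr_ge0 => i _; apply: sqn_ge0.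
Qed.

Lemma rows_inM n d e (S : {set 'I_n}) (A : 'M[R]_(n, d)) (B : 'M[R]_(d, e)) :
  rows_in S (A *m B) = rows_in S A *m B.
Proof. by apply/matrixP => i j; rewrite !mxE; apply: eq_bigr => k _; rewrite !mxE. Qed.

Lemma rows_inB n d (S : {set 'I_n}) (A B : 'M[R]_(n, d)) :
  rows_in S (A - B) = rows_in S A - rows_in S B.
Proof. by apply/matrixP => i j; rewrite !mxE. Qed.

Definition gram_in n d (S : {set 'I_n}) (U : 'M[R]_(n, d)) : 'M[R]_d :=
  (rows_in S U)^T *m rows_in S U.

(* A polynomial condition on [U] which implies [well_sampled S U]; unlike the
   latter it is obviously measurable in [U]. *)
Definition concentrated n d (P : nat) (S : {set 'I_n}) (U : 'M[R]_(n, d)) : bool :=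
  sqn ((gram_in S U - (#|S|%:R / n%:R)%:M) ^+ P) <= (#|S|%:R / (2 * n%:R)) ^+ P.*2.

Lemma eigenvector_exp d (B : 'M[R]_d) (v : 'rV[R]_d) b m :
  v *m B = b *: v -> v *m B ^+ m = b ^+ m *: v.
Proof.
move=> vB; elim: m => [|m ih]; first by rewrite !expr0 mulmx1 scale1r.
by rewrite exprS -mulmxE mulmxA vB -scalemxAl ih scalerA -exprS.
Qed.

(** An eigenvector for [a] is one of the deviation for [a - c], so [(a - c)^(2P)] is at most the
    squared Frobenius norm of the [P]-th power; then a root is taken. *)
Lemma concentrated_well_sampled n d P (S : {set 'I_n}) (U : 'M[R]_(n, d)) :
  (0 < P)%N -> concentrated P S U -> well_sampled S U.
Proof.
move=> P0; rewrite /concentrated => conc a /eigenvalueP[v vG v0].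
rewrite -/(gram_in S U) in vG; set c := #|S|%:R / n%:R.
have c_ge0 : 0 <= c by rewrite divr_ge0.
have vB : v *m (gram_in S U - c%:M) = (a - c) *: v.
  by rewrite mulmxBr vG mul_mx_scalar scalerBl.
have v_gt0 : 0 < sqn v by rewrite lt0r sqn_eq0 v0 sqn_ge0.
have h : ((a - c) ^+ 2) ^+ P <= ((c / 2) ^+ 2) ^+ P.
  have -> : ((c / 2) ^+ 2) ^+ P = (#|S|%:R / (2 * n%:R)) ^+ P.*2.
    rewrite -exprM mul2n; congr (_ ^+ _); rewrite /c invfM; ring.
  apply: le_trans conc; rewrite -(ler_pM2l v_gt0); apply: le_trans (sqnM _ _).
  by rewrite (eigenvector_exp _ vB) sqnZ mulrC -!exprM mulnC.
have {}h : (a - c) ^+ 2 <= (c / 2) ^+ 2.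
  by rewrite -(ler_pXn2r P0) ?nnegrE ?sqr_ge0.
have : `|a - c| <= c / 2.
  by rewrite -(@ler_pXn2r _ 2%N) ?nnegrE ?divr_ge0// real_normK ?num_real.
by rewrite ler_distl -/c => /andP[h1 h2]; apply/andP; split; lra.
Qed.

End SampledRows.

(** * Average over the sample of the captured part of the error *)

Section ExpectedCapture.
Context {R : realType}.
Variables (n d e P : nat) (rho : {set 'I_n} -> R) (q L : R).
Hypothesis rho_ge0 : forall S, 0 <= rho S.
Hypothesis rho_swap : forall i j S, rho (swap i j S) = rho S.
Hypothesis rho_large : forall S : {set 'I_n}, rho S != 0 -> q <= #|S|%:R.
Hypothesis n_gt0 : (0 < n)%N.
Hypothesis q_gt0 : 0 < q.
Hypothesis P_gt0 : (0 < P)%N.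
Variables (U : 'M[R]_(n, d)) (X : 'M[R]_(n, e)).
Hypothesis UU : U^T *m U = 1%:M.
Hypothesis UX : U^T *m X = 0.
Hypothesis UL : forall i, sqn (row i U) <= L.
Hypothesis LP : 150 * L * n%:R * P%:R <= q.
Hypothesis dP : d%:R * 3^-1 ^+ P <= q / (4 * n%:R).

(** The trace of the quadratic form in [s] that bounds [|r|^2] from below, cut to 0 where the
    spectral condition is not guaranteed. *)
Definition capture (S : {set 'I_n}) : R :=
  if concentrated P S U then
    sqn (rows_in S X) - 2 * n%:R / #|S|%:R * sqn ((rows_in S U)^T *m rows_in S X)
  else 0.

Let nr_gt0 : 0 < n%:R :> R. Proof. by rewrite ltr0n. Qed.

Let sum_outer_UX : \sum_i (row i U)^T *m row i X = 0.
Proof. by rewrite -trmxM_outer. Qed.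

Let sum_outer_UU : \sum_i (row i U)^T *m row i U = 1%:M.
Proof. by rewrite -trmxM_outer. Qed.

Let capture_card k : (0 < k)%N -> q <= k%:R ->
  q / (2 * n%:R) * sqn X * \sum_(S : {set 'I_n} | #|S| == k) rho S <=
  \sum_(S : {set 'I_n} | #|S| == k) rho S * capture S.
Proof.
move=> k_gt0 qk; pose phi (S : {set 'I_n}) := if #|S| == k then rho S else 0.
have phi_ge0 S : 0 <= phi S by rewrite /phi; case: ifP.
have phi_swap i j S : phi (swap i j S) = phi S.
  by rewrite /phi /swap card_imset; [rewrite -/(swap i j S) rho_swap|exact: perm_inj].
have phi_card S : phi S != 0 -> #|S| = k.
  by rewrite /phi; case: ifP => [/eqP//|]; rewrite eqxx.
have kr_gt0 : 0 < k%:R :> R by rewrite ltr0n.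
have L_ge0 : 0 <= L by apply: le_trans (sqn_ge0 _) (UL (Ordinal n_gt0)).
rewrite big_mkcond /= [X in _ <= X]big_mkcond /=.
rewrite -/(phi _); set Phi := \sum_S _.
have Phi_ge0 : 0 <= Phi by apply: sumr_ge0 => S _; apply: phi_ge0.
pose A S := sqn (rows_in S X).
pose B (S : {set 'I_n}) := sqn (\sum_(i in S) (row i U)^T *m row i X).
pose bad S := (k%:R / (2 * n%:R)) ^+ P.*2 < sqn (gram_dev k U S ^+ P).
(* Cutting to 0 on a bad set costs at most [|X|^2], since the uncut expression never exceeds it. *)
have lb : \sum_(S : {set 'I_n}) phi S *
      (A S - 2 * n%:R / k%:R * B S - (if bad S then sqn X else 0)) <=
    \sum_(S : {set 'I_n}) (if #|S| == k then rho S * capture S else 0).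
  apply: ler_sum => S _; rewrite /phi; case: ifP => [/eqP Sk|_]; last by rewrite mul0r.
  rewrite ler_wpM2l// /capture.
  have -> : concentrated P S U = ~~ bad S.
    rewrite /concentrated /bad -leNgt Sk /gram_dev /centered_sum sum_outer_UU.
    by rewrite /gram_in rows_in_trM scalemx1.
  have -> : 2 * n%:R / #|S|%:R = 2 * n%:R / k%:R :> R by rewrite Sk.
  rewrite rows_in_trM -/(B S) -/(A S); case: (bad S) => /=; last by rewrite subr0.
  have AX : A S <= sqn X by apply: sqn_rows_in_le.
  have BS : 0 <= 2 * n%:R / k%:R * B S by rewrite !mulr_ge0 ?sqn_ge0 ?invr_ge0.
  by lra.
apply: le_trans lb.
under eq_bigr do rewrite 2!mulrBr.
rewrite !sumrB.
have -> : \sum_(S : {set 'I_n}) phi S * A S = k%:R / n%:R * Phi * sqn X.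
  rewrite sqn_rows -(first_moment phi_swap phi_card n_gt0).
  by apply: eq_bigr => S _; rewrite /A sqn_rows_in.
have hB : \sum_(S : {set 'I_n}) phi S * (2 * n%:R / k%:R * B S) <= 4 * L * Phi * sqn X.
  have -> : \sum_(S : {set 'I_n}) phi S * (2 * n%:R / k%:R * B S) =
      2 * n%:R / k%:R * \sum_S phi S * B S.
    by rewrite mulr_sumr; apply: eq_bigr => S _; rewrite mulrCA.
  have h := second_moment_le phi_ge0 phi_swap phi_card n_gt0 sum_outer_UX.
  have nk_ge0 : 0 <= 2 * n%:R / k%:R :> R by rewrite !mulr_ge0 ?invr_ge0.
  apply: le_trans (ler_wpM2l nk_ge0 h) _.
  have -> : 4 * L * Phi * sqn X = 2 * n%:R / k%:R *
      (2 * (k%:R / n%:R) * Phi * (L * sqn X)) by field; rewrite !gt_eqF.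
  rewrite ler_wpM2l// ler_wpM2l ?mulr_ge0 ?invr_ge0//.
  rewrite (sqn_rows X) mulr_sumr; apply: ler_sum => i _.
  by rewrite sqn_rank1 sqnT ler_wpM2r ?sqn_ge0.
have hbad : \sum_(S : {set 'I_n}) phi S * (if bad S then sqn X else 0) <=
    q / (4 * n%:R) * Phi * sqn X.
  have -> : \sum_(S : {set 'I_n}) phi S * (if bad S then sqn X else 0) =
      sqn X * \sum_(S | bad S) phi S.
    rewrite mulr_sumr [RHS]big_mkcond /=; apply: eq_bigr => S _.
    by case: ifP; rewrite ?mulr0// mulrC.
  rewrite mulrC ler_wpM2r ?sqn_ge0//.
  apply: le_trans (gram_dev_tail phi_ge0 phi_swap phi_card n_gt0 k_gt0 UU UL _) _.
    exact: le_trans LP qk.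
  by rewrite ler_wpM2r.
have PhiX_ge0 : 0 <= Phi * sqn X by rewrite mulr_ge0 ?sqn_ge0.
have c1 : q / (2 * n%:R) * sqn X * Phi = q / (2 * n%:R) * (Phi * sqn X) by ring.
rewrite c1 -!(mulrA _ Phi) in hB hbad *.
have hq : q / n%:R * (Phi * sqn X) <= k%:R / n%:R * (Phi * sqn X).
  by rewrite ler_wpM2r// ler_wpM2r// invr_ge0 ltW.
(* In units of [q/n], the first moment gives at least 1, the second moment costs at most
   [4/150 < 1/37] and the bad sets 1/4, which leaves more than 1/2. *)
have hL : 4 * L * (Phi * sqn X) <= q / n%:R / 37 * (Phi * sqn X).
  rewrite ler_wpM2r// ler_pdivlMr// ler_pdivlMr//.
  have P1 : 1 <= P%:R :> R by rewrite ler1n.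
  have Ln : 0 <= L * n%:R by rewrite mulr_ge0// ltW.
  have := ler_wpM2l Ln P1; rewrite mulr1 => LnP.
  apply: le_trans (_ : 150 * (L * n%:R * P%:R) <= _); last by rewrite !mulrA.
  by rewrite (_ : 4 * L * 37 * n%:R = 148 * (L * n%:R)); [lra|ring].
have e1 : q / (2 * n%:R) = q / n%:R / 2 by field; rewrite gt_eqF.
have e2 : q / (4 * n%:R) = q / n%:R / 4 by field; rewrite gt_eqF.
rewrite e1; rewrite e2 in hbad.
have qnPX : 0 <= q / n%:R * (Phi * sqn X) by rewrite mulr_ge0// divr_ge0 ?ltW.
by lra.
Qed.

(** Swaps preserve the cardinality, so the law splits into swap-invariant weights, one for each size
    of the sample. *)
Lemma expected_capture :
  q / (2 * n%:R) * sqn X * \sum_S rho S <= \sum_S rho S * capture S.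
Proof.
have by_card (f : {set 'I_n} -> R) :
    \sum_S f S = \sum_(k < n.+1) \sum_(S : {set 'I_n} | #|S| == k) f S.
  rewrite (exchange_big_dep xpredT)//=; apply: eq_bigr => S _.
  have Sn : (#|S| < n.+1)%N by rewrite ltnS -[X in (_ <= X)%N]card_ord max_card.
  rewrite (bigD1 (Ordinal Sn))//= big1 ?addr0// => k /andP[/eqP Sk /eqP kS].
  by case: kS; apply: val_inj.
rewrite !by_card mulr_sumr; apply: ler_sum => k _.
have [qk|kq] := leP q (k : nat)%:R.
  by apply: capture_card => //; rewrite -(ltr0n R) (lt_le_trans q_gt0).
rewrite !big1 ?mulr0// => S /eqP Sk; have [->|/rho_large] := eqVneq (rho S) 0.
all: rewrite ?mul0r// Sk leNgt kq//.
Qed.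

End ExpectedCapture.

(** * From a lower bound on the eigenvalues to one on the quadratic form *)

Section RayleighQuotient.
Context {R : realType}.
Variable d : nat.
Implicit Types (B G : 'M[R]_d) (z : 'cV[R]_d).

Lemma mxdot_sym B (x y : 'cV[R]_d) : B^T = B -> mxdot x (B *m y) = mxdot y (B *m x).
Proof. by move=> sB; rewrite mxdotC mxdotMl sB. Qed.

Lemma form_le B : exists2 K : R, 0 < K & forall z, mxdot z (B *m z) <= K * sqn z.
Proof.
exists ((1 + sqn B) / 2) => [|z]; first by rewrite divr_gt0// ltr_pwDl ?sqn_ge0.
have := mxdot_le z (B *m z); have := sqnM B z; lra.
Qed.

(** Positivity is tested at [z - K^-1 B z], a gradient step of length [1/K]; this avoids a matrix
    square root. *)
Lemma psd_sqn_le B : B^T = B -> (forall z, 0 <= mxdot z (B *m z)) ->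
  exists2 K : R, 0 < K & forall z, sqn (B *m z) <= K * mxdot z (B *m z).
Proof.
move=> sB psd; have [K K0 leK] := form_le B; exists K => // z.
have := psd (z - K^-1 *: (B *m z)).
rewrite mulmxBr -scalemxAr mxdotBr mxdotZr ![mxdot (_ - _) _]mxdotC !mxdotBr.
rewrite !mxdotZr ![mxdot (B *m (B *m z)) _]mxdotC (mxdot_sym z (B *m z) sB).
rewrite ![mxdot (B *m z) z]mxdotC -/(sqn (B *m z)).
have := leK (B *m z); set f := mxdot _ (B *m (B *m z)); set g := mxdot z _.
move=> fK h; rewrite mulrC -ler_pdivrMr// [X in X <= _]mulrC.
rewrite -/(sqn (B *m z)) in h.
have Ki : 0 <= K^-1 by rewrite invr_ge0 ltW.
have := ler_wpM2l Ki (ler_wpM2l Ki fK); rewrite mulKf ?gt_eqF//; lra.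
Qed.

(* If [m] is the infimum of the Rayleigh quotient of [G] then [G - m] is
   positive semidefinite, and it is singular: otherwise it would be bounded
   below by a positive multiple of the identity. *)
Lemma form_ge_eigenvalue G c : G^T = G ->
  (forall a, eigenvalue G a -> c <= a) ->
  forall z, c * sqn z <= mxdot z (G *m z).
Proof.
move=> sG eigG z; have [->|z0] := eqVneq z 0.
  by rewrite sqn0 mulmx0 /mxdot mulmx0 mxtrace0 mulr0.
pose quot (x : 'cV[R]_d) := mxdot x (G *m x) / sqn x.
have sqn_gt0 (x : 'cV[R]_d) : x != 0 -> 0 < sqn x by move=> x0; rewrite lt0r sqn_eq0 x0 sqn_ge0.
pose A := [set quot x | x in [set x | x != 0]].
have A0 : A !=set0 by exists (quot z), z.
have [K K0 leK] := form_le (- G).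
have lbA : lbound A (- K).
  move=> _ [x x0 <-]; rewrite ler_pdivlMr ?sqn_gt0//.
  by have := leK x; rewrite mulNmx -scaleN1r mxdotZr; lra.
pose m := inf A.
have mle (x : 'cV[R]_d) : m * sqn x <= mxdot x (G *m x).
  have [->|x0] := eqVneq x 0; first by rewrite sqn0 mulmx0 /mxdot mulmx0 mxtrace0 mulr0.
  by rewrite -ler_pdivlMr ?sqn_gt0//; apply: ge_inf; [exists (- K)|exists x].
suff : eigenvalue G m by move/eigG => cm; apply: le_trans (mle z); rewrite ler_wpM2r ?sqn_ge0.
pose B := G - m%:M.
have BE (x : 'cV[R]_d) : mxdot x (B *m x) = mxdot x (G *m x) - m * sqn x.
  by rewrite /B mulmxBl mul_scalar_mx mxdotBr mxdotZr.
have sB : B^T = B by rewrite /B linearB /= sG tr_scalar_mx.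
have [x|C C0 leC] := psd_sqn_le sB; first by rewrite BE subr_ge0.
rewrite /eigenvalue /eigenspace -/B kermx_eq0 row_free_unit; apply/negP => uB.
pose D := (1 + sqn (invmx B)) * C.
have D0 : 0 < D by rewrite mulr_gt0// ltr_pwDl ?sqn_ge0.
have leD (x : 'cV[R]_d) : sqn x <= D * mxdot x (B *m x).
  rewrite -{1}[x](mulKmx uB) (le_trans (sqnM _ _))// /D -mulrA.
  have psd : 0 <= C * mxdot x (B *m x) by apply: le_trans (leC x); apply: sqn_ge0.
  apply: le_trans (ler_wpM2l (sqn_ge0 _) (leC x)) _.
  by rewrite ler_wpM2r// lerDr.
have : m + D^-1 <= m.
  apply: lb_le_inf => // _ [x x0 <-]; rewrite ler_pdivlMr ?sqn_gt0//.
  have := leD x; rewrite -ler_pdivrMl// BE; lra.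
by rewrite gerDl leNgt invr_gt0 D0.
Qed.

End RayleighQuotient.

(** * Least squares, the residual and the rank-one update *)

Section GrouseUpdate.
Context {R : realType}.

Lemma l2norm_sqr m n (A : 'M[R]_(m, n)) : l2norm A ^+ 2 = sqn A.
Proof. by rewrite /l2norm sqr_sqrtr -sqnE// sqn_ge0. Qed.

Lemma l2normE m n (A : 'M[R]_(m, n)) : l2norm A = Num.sqrt (sqn A).
Proof. by rewrite sqnE. Qed.

Lemma l2norm_eq0 m n (A : 'M[R]_(m, n)) : (l2norm A == 0) = (A == 0).
Proof. by rewrite -(sqrf_eq0 (l2norm A)) l2norm_sqr sqn_eq0. Qed.

Variables n d : nat.
Implicit Types (U Ubar : 'M[R]_(n, d)) (v r p : 'cV[R]_n) (w s : 'cV[R]_d)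
  (S : {set 'I_n}).

Lemma lsq_normal_eq S U v w : is_lsq_argmin S U v w ->
  (rows_in S U)^T *m (rows_in S v - rows_in S U *m w) = 0.
Proof.
set A := rows_in S U; set b := rows_in S v; move=> opt.
set g := A^T *m (b - A *m w).
have key (t : R) : 0 <= t ^+ 2 * sqn (A *m g) - 2 * t * sqn g.
  have := opt (w + t *: g); rewrite !l2norm_sqr -/A -/b.
  have -> : A *m (w + t *: g) - b = (A *m w - b) + t *: (A *m g).
    by rewrite mulmxDr -scalemxAr addrAC.
  rewrite [sqn (_ + t *: _)]sqnD sqnZ mxdotZr mxdotC mxdotMl.
  have -> : A^T *m (A *m w - b) = - g by rewrite -mulmxN opprB.
  by rewrite -[- g]scaleN1r mxdotZr -/(sqn g); lra.
apply/eqP; rewrite -sqn_eq0; apply/eqP/le_anti; rewrite sqn_ge0 andbT leNgt.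
apply/negP => g0.
have Q0 : 0 < sqn (A *m g) + 1 by rewrite ltr_wpDl ?sqn_ge0.
(* A step length along the gradient that strictly decreases the objective; the added 1 keeps the
   denominator positive when [A *m g = 0]. *)
have := key (sqn g / (sqn (A *m g) + 1)).
have -> : (sqn g / (sqn (A *m g) + 1)) ^+ 2 * sqn (A *m g) -
    2 * (sqn g / (sqn (A *m g) + 1)) * sqn g =
  - ((sqn g / (sqn (A *m g) + 1)) ^+ 2 * (sqn (A *m g) + 2)).
  move: (sqn g) (sqn (A *m g)) Q0 => a c Q0; by field; rewrite gt_eqF.
rewrite oppr_ge0 leNgt mulr_gt0// ?exprn_gt0 ?divr_gt0//.
by rewrite ltr_wpDl ?sqn_ge0.
Qed.

Lemma residual_trM m (A : 'M[R]_(n, m)) S v p :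
  A^T *m residual S v p = (rows_in S A)^T *m rows_in S (v - p).
Proof.
rewrite trmxM_outer rows_in_trM [RHS]big_mkcond /=; apply: eq_bigr => i _.
case: ifPn => iS; first by congr (_ *m _); apply/matrixP => a b; rewrite !ord1 !mxE iS.
have -> : row i (residual S v p) = 0.
  by apply/matrixP => a b; rewrite !mxE (negbTE iS).
by rewrite mulmx0.
Qed.

Lemma sqn_residual S v p : sqn (residual S v p) = sqn (rows_in S (v - p)).
Proof.
rewrite sqn_rows_in sqn_rows [RHS]big_mkcond /=; apply: eq_bigr => i _.
case: ifPn => iS; first by congr sqn; apply/matrixP => a b; rewrite !ord1 !mxE iS.
by rewrite -(sqn0 1 1); congr sqn; apply/matrixP => a b; rewrite !mxE (negbTE iS).
Qed.

Lemma residual_orth S U v w : is_lsq_argmin S U v w ->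
  U^T *m residual S v (U *m w) = 0.
Proof. by move/lsq_normal_eq; rewrite residual_trM rows_inB rows_inM. Qed.

Section Step.
Variables (U : 'M[R]_(n, d)) (w : 'cV[R]_d) (r : 'cV[R]_n) (sigma eta : R).
Hypothesis UU : U^T *m U = 1%:M.
Hypothesis Ur : U^T *m r = 0.
Hypothesis r0 : r = 0 -> sin (sigma * eta) = 0.

Local Notation theta := (sigma * eta).
Let what := (l2norm w)^-1 *: w.
Let y : 'cV[R]_n := cos theta *: (U *m what) + sin theta *: ((l2norm r)^-1 *: r).

Let l2norm_Uw : l2norm (U *m w) = l2norm w.
Proof. by rewrite !l2normE sqn_isom. Qed.

(** A rotation in one plane: the direction [U *m what] is carried to [y], and [U *m b] stays fixed
    for [b] orthogonal to [what]. *)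
Lemma grouse_updateE :
  grouse_update U w r sigma eta = U + (y - U *m what) *m what^T.
Proof.
rewrite /grouse_update l2norm_Uw.
have -> : what^T = (l2norm w)^-1 *: w^T by rewrite /what linearZ.
have -> // : y - U *m what = (cos theta - 1) *: ((l2norm w)^-1 *: (U *m w))
    + sin theta *: ((l2norm r)^-1 *: r).
by rewrite /y /what -scalemxAr scalerBl scale1r addrAC.
Qed.

Lemma grouse_update0 : w = 0 -> grouse_update U w r sigma eta = U.
Proof. by move=> w0; rewrite /grouse_update w0 trmx0 scaler0 mulmx0 addr0. Qed.

Let sqn_what : w != 0 -> sqn what = 1.
Proof.
by move=> w0; rewrite sqnZ -l2norm_sqr -exprMn mulVf ?expr1n// l2norm_eq0.
Qed.

Let sin_rhat : sin theta ^+ 2 * sqn ((l2norm r)^-1 *: r) = sin theta ^+ 2.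
Proof.
have [/r0 -> |rn0] := eqVneq r 0; first by rewrite expr0n mul0r.
by rewrite sqnZ -l2norm_sqr -exprMn mulVf ?expr1n ?mulr1// l2norm_eq0.
Qed.

Let Uy : U^T *m y = cos theta *: what.
Proof.
by rewrite /y mulmxDr -!scalemxAr Ur !scaler0 addr0 mulmxA UU mul1mx.
Qed.

Let sqn_y : w != 0 -> sqn y = 1.
Proof.
move=> w0; rewrite /y sqnD !sqnZ sqn_isom// -!/(what) sqn_what// mulr1.
rewrite -sqnZ sin_rhat !mxdotZr mxdotC mxdotZr mxdotC mxdotMl Ur.
rewrite /mxdot mulmx0 mxtrace0 !mulr0 addr0; exact: cos2Dsin2.
Qed.

(** The coefficient of [what *m what^T] cancels: the two cross terms give [2 (cos theta - 1)], the
    square of [z] gives [2 - 2 cos theta]. *)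
Lemma grouse_update_orthonormal : orthonormal_cols (grouse_update U w r sigma eta).
Proof.
have [w0|w0] := eqVneq w 0; first by rewrite grouse_update0.
rewrite /orthonormal_cols grouse_updateE; set z := y - _.
have Uz : U^T *m z = (cos theta - 1) *: what.
  by rewrite mulmxBr Uy mulmxA UU mul1mx scalerBl scale1r.
have zz : z^T *m z = (2 - 2 * cos theta)%:M.
  rewrite [LHS]mx11_scalar; congr (_%:M).
  have -> : (z^T *m z) 0 0 = sqn z by rewrite /sqn /mxtrace big_ord1.
  rewrite sqnB sqn_y// mxdotC mxdotMl Uy mxdotZr sqn_isom//.
  by rewrite -[mxdot what what]/(sqn what) sqn_what//; ring.
have -> : (U + z *m what^T)^T = U^T + what *m z^T.
  by rewrite [LHS](raddfD trmx) /= trmx_mul trmxK.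
rewrite mulmxDl !mulmxDr UU.
rewrite [U^T *m _]mulmxA Uz -!mulmxA.
have -> : z^T *m U = (cos theta - 1) *: what^T.
  by rewrite -[LHS]trmxK trmx_mul trmxK Uz linearZ.
rewrite [z^T *m _]mulmxA zz mul_scalar_mx -scalemxAl -!scalemxAr -addrA.
rewrite -!scalerDl -[RHS]addr0; congr (_ + _).
rewrite [X in X *: _](_ : _ = 0) ?scale0r//; ring.
Qed.

Lemma grouse_update_err (Ubar : 'M[R]_(n, d)) : w != 0 ->
  subspace_err Ubar (grouse_update U w r sigma eta) =
  subspace_err Ubar U + sqn (Ubar^T *m (U *m what)) - sqn (Ubar^T *m y).
Proof.
move=> w0; rewrite /subspace_err !l2norm_sqr grouse_updateE.
rewrite mulmxDr mulmxA sqnD sqn_rank1 sqnT sqn_what// mulr1.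
have -> : mxdot (Ubar^T *m U) (Ubar^T *m (y - U *m what) *m what^T) =
    mxdot (Ubar^T *m (U *m what)) (Ubar^T *m (y - U *m what)).
  by rewrite /mxdot !trmx_mul -!mulmxA [RHS]mxtrace_mulC -!mulmxA.
rewrite mulmxBr; move: (Ubar^T *m (U *m what)) (Ubar^T *m y) => a b.
by rewrite sqnB mxdotBr [mxdot b a]mxdotC -/(sqn a); ring.
Qed.

End Step.
End GrouseUpdate.

(** * The subspace error and the row norms of the iterates *)

Section SubspaceError.
Context {R : realType}.
Variables n d : nat.
Implicit Types (U Ubar : 'M[R]_(n, d)).

Definition orth_compl U Ubar : 'M[R]_(n, d) := Ubar - U *m U^T *m Ubar.

Lemma trM_orth_compl U Ubar : orthonormal_cols U -> U^T *m orth_compl U Ubar = 0.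
Proof. by move=> UU; rewrite /orth_compl mulmxBr !mulmxA UU mul1mx subrr. Qed.

Lemma sqn_orthonormal U : orthonormal_cols U -> sqn U = d%:R.
Proof. by move=> UU; rewrite /sqn UU mxtrace1. Qed.

Lemma subspace_errE U Ubar : orthonormal_cols U -> orthonormal_cols Ubar ->
  subspace_err Ubar U = sqn (orth_compl U Ubar).
Proof.
move=> UU BB; rewrite sqn_proj_compl// sqn_orthonormal// /subspace_err l2norm_sqr.
by rewrite -[in RHS]sqnT trmx_mul trmxK.
Qed.

Lemma subspace_err_ge0 U Ubar : orthonormal_cols U -> orthonormal_cols Ubar ->
  0 <= subspace_err Ubar U.
Proof. by move=> UU BB; rewrite subspace_errE// sqn_ge0. Qed.

Lemma subspace_err_le U Ubar : subspace_err Ubar U <= d%:R.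
Proof. by rewrite /subspace_err gerBl sqr_ge0. Qed.

Lemma subspace_errC U Ubar : subspace_err Ubar U = subspace_err U Ubar.
Proof. by rewrite /subspace_err !l2norm_sqr -[in RHS]sqnT trmx_mul trmxK. Qed.

(** This passes incoherence from [Ubar] to [U]: project [U] on the range of [Ubar]; what is left has
    squared norm equal to the error, which is symmetric in the two subspaces. *)
Lemma sqn_row_le_err U Ubar i : orthonormal_cols U -> orthonormal_cols Ubar ->
  sqn (row i U) <= 2 * sqn (row i Ubar) + 2 * subspace_err Ubar U.
Proof.
move=> UU BB; have -> : row i U =
    row i Ubar *m (Ubar^T *m U) + row i (orth_compl Ubar U).
  by rewrite -row_mul -raddfD /orth_compl !mulmxA addrC subrK.
apply: le_trans (sqnD_le _ _) _; rewrite lerD// ler_wpM2l//.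
  rewrite -sqnT !trmx_mul trmxK -mulmxA (le_trans (sqn_trM_le _ UU))//.
  by rewrite sqn_isom// sqnT.
rewrite subspace_errC subspace_errE// [X in _ <= X]sqn_rows (bigD1 i)//= lerDl.
by apply: sumr_ge0 => j _; apply: sqn_ge0.
Qed.

End SubspaceError.

(** * Pathwise bound for one step *)

Section GrouseStepBound.
Context {R : realType}.
Variables n d : nat.

(** The bound on [|r|^2] as a quadratic form in [s]: its matrix involves only the iterate and the
    sample, so [s] can be averaged separately. *)
Definition capture_mx (S : {set 'I_n}) (U X : 'M[R]_(n, d)) : 'M[R]_d :=
  (rows_in S X)^T *m rows_in S X - (2 * n%:R / #|S|%:R) *:
    (((rows_in S X)^T *m rows_in S U) *m ((rows_in S U)^T *m rows_in S X)).

Lemma capture_mx_form S U X (s : 'cV[R]_d) :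
  mxdot s (capture_mx S U X *m s) = sqn (rows_in S (X *m s)) -
    2 * n%:R / #|S|%:R * sqn ((rows_in S U)^T *m rows_in S (X *m s)).
Proof.
rewrite /capture_mx mulmxBl -scalemxAl mxdotBr mxdotZr rows_inM.
congr (_ - _ * _); first by rewrite [RHS]/sqn -[RHS]/(mxdot _ _) mxdotMl !mulmxA.
by rewrite -[RHS]/(mxdot _ _) !mxdotMl trmxK -!mulmxA.
Qed.

Lemma tr_capture_mx S U X : \tr (capture_mx S U X) =
  sqn (rows_in S X) - 2 * n%:R / #|S|%:R * sqn ((rows_in S U)^T *m rows_in S X).
Proof.
rewrite /capture_mx raddfB /= mxtraceZ /sqn; congr (_ - _ * \tr (_ *m _)).
by rewrite trmx_mul trmxK.
Qed.

Variables (U Ubar : 'M[R]_(n, d)) (S : {set 'I_n}) (s w : 'cV[R]_d) (sigma eta q : R).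
Hypothesis d_gt0 : (0 < d)%N.
Hypothesis UU : orthonormal_cols U.
Hypothesis BB : orthonormal_cols Ubar.
Hypothesis q_gt0 : 0 < q.
Hypothesis qS : q <= #|S|%:R.
Hypothesis err_small : subspace_err Ubar U <= 1 / 128 * (q ^+ 2 / (n%:R ^+ 2 * d%:R)).
Hypothesis WS : well_sampled S U.
Hypothesis wopt : is_lsq_argmin S U (Ubar *m s) w.

Local Notation v := (Ubar *m s).
Local Notation r := (residual S v (U *m w)).
Local Notation theta := (sigma * eta).
Local Notation eps := (subspace_err Ubar U).
Local Notation X := (orth_compl U Ubar).
Let x := X *m s.
Let A := rows_in S U.
Let xS := rows_in S x.
(** The error of the fitted weights relative to the orthogonal projection of the complete vector
    [v]. *)
Let z := w - U^T *m v.
Let k : R := #|S|%:R.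

Let k_gt0 : 0 < k. Proof. exact: lt_le_trans q_gt0 qS. Qed.

Let k_le_n : k <= n%:R.
Proof. by rewrite ler_nat -[X in (_ <= X)%N]card_ord max_card. Qed.

Let n_gt0 : 0 < n%:R :> R. Proof. exact: lt_le_trans k_gt0 k_le_n. Qed.

Let eps_ge0 : 0 <= eps. Proof. exact: subspace_err_ge0. Qed.

Let xE : x = v - U *m (U^T *m v).
Proof. by rewrite /x /orth_compl mulmxBl !mulmxA. Qed.

Let Ux : U^T *m x = 0.
Proof. by rewrite /x mulmxA trM_orth_compl// mul0mx. Qed.

Let wE : w = U^T *m v + z. Proof. by rewrite /z addrC subrK. Qed.

Let diffE : v - U *m w = x - U *m z.
Proof. by rewrite xE /z mulmxBr opprB addrA subrK. Qed.

Let rS : rows_in S (v - U *m w) = xS - A *m z.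
Proof. by rewrite diffE rows_inB rows_inM. Qed.

Let normal_eq : A^T *m xS = A^T *m (A *m z).
Proof.
have := lsq_normal_eq wopt; rewrite -rows_inM -rows_inB rS -/A mulmxBr.
by move/eqP; rewrite subr_eq0 => /eqP.
Qed.

Let sqn_r : sqn r = sqn xS - sqn (A *m z).
Proof.
rewrite sqn_residual rS sqnB [mxdot xS _]mxdotC mxdotMl normal_eq -mxdotMl.
by rewrite -/(sqn _); ring.
Qed.

Let sqn_z_le : k / (2 * n%:R) * sqn z <= sqn (A *m z).
Proof.
have GT : (gram_in S U)^T = gram_in S U by rewrite /gram_in trmx_mul trmxK.
have eigG a : eigenvalue (gram_in S U) a -> k / (2 * n%:R) <= a.
  move=> /WS /andP[h _]; apply: le_trans h; rewrite -/k invfM.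
  by rewrite le_eqVlt; apply/orP; left; apply/eqP; ring.
have := form_ge_eigenvalue GT eigG z.
by rewrite /gram_in -mulmxA -mxdotMl -/(sqn _).
Qed.

Let sqn_x_le : sqn x <= eps * sqn s.
Proof. by rewrite subspace_errE// sqnM. Qed.

Let sqn_xS_le : sqn xS <= eps * sqn s.
Proof. exact: le_trans (sqn_rows_in_le _ _) sqn_x_le. Qed.

Let sqn_Az_le : sqn (A *m z) <= eps * sqn s.
Proof.
by apply: le_trans sqn_xS_le; rewrite -subr_ge0 -sqn_r sqn_ge0.
Qed.

Let sqn_r_le : sqn r <= eps * sqn s.
Proof. by rewrite sqn_r lerBlDr (le_trans sqn_xS_le)// lerDl sqn_ge0. Qed.

Local Notation kappa := (n%:R / q).

Let kappa_ge1 : 1 <= kappa.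
Proof. by rewrite ler_pdivlMr// mul1r (le_trans qS). Qed.

Let kappa_eps : kappa * eps <= 1 / 128.
Proof.
have kappa_ge0 : 0 <= kappa by apply: le_trans kappa_ge1.
apply: le_trans (ler_wpM2l kappa_ge0 err_small) _.
have d1 : 1 <= d%:R :> R by rewrite ler1n.
have -> : kappa * (1 / 128 * (q ^+ 2 / (n%:R ^+ 2 * d%:R))) = 1 / 128 * (q / (n%:R * d%:R)).
  by field; rewrite !gt_eqF// ltr0n.
have d0 : 0 < d%:R :> R by rewrite ltr0n.
apply: ler_piMr => //; rewrite ler_pdivrMr ?mulr_gt0// mul1r.
by rewrite (le_trans qS)// (le_trans k_le_n)// ler_peMr// ltW.
Qed.

Let eps_le : eps <= 1 / 128.
Proof. by apply: le_trans kappa_eps; rewrite ler_peMl. Qed.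

Let sqn_z_le' : sqn z <= 2 * kappa * (eps * sqn s).
Proof.
have h : q / (2 * n%:R) * sqn z <= eps * sqn s.
  apply: le_trans sqn_Az_le; apply: le_trans sqn_z_le.
  by rewrite ler_wpM2r ?sqn_ge0// ler_wpM2r// invr_ge0 mulr_ge0// ltW.
have -> : 2 * kappa * (eps * sqn s) = (q / (2 * n%:R))^-1 * (eps * sqn s).
  by field; rewrite !gt_eqF.
by rewrite ler_pdivlMl// divr_gt0// mulr_gt0.
Qed.

Let sqn_z_small : sqn z <= sqn s / 64.
Proof.
apply: le_trans sqn_z_le' _.
have -> : 2 * kappa * (eps * sqn s) = 2 * (kappa * eps) * sqn s by ring.
have := ler_wpM2r (sqn_ge0 s) kappa_eps; lra.
Qed.

Let sqn_UTv : sqn (U^T *m v) = sqn s - sqn x.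
Proof.
have := sqn_proj_compl v UU; rewrite -mulmxA -xE => ->.
by rewrite (sqn_isom _ BB); ring.
Qed.

Lemma sqn_fit_bounds : 9 / 16 * sqn s <= sqn (U *m w) <= 81 / 64 * sqn s.
Proof.
rewrite (sqn_isom _ UU) wE sqnD.
(* The weight 8 matches [|z| <= |s|/8]: the upper bound becomes [9/8 + 9/64 = 81/64]. *)
have h1 := sqn_ge0 (U^T *m v - 8 *: z).
have h2 := sqn_ge0 (U^T *m v + 8 *: z).
rewrite sqnB sqnZ mxdotZr in h1; rewrite sqnD sqnZ mxdotZr in h2.
have x0 := sqn_ge0 x; have e := ler_wpM2r (sqn_ge0 s) eps_le.
have xs := sqn_x_le; have zs := sqn_z_small; have s0 := sqn_ge0 s.
rewrite sqn_UTv in h1 h2 *.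
by apply/andP; split; lra.
Qed.

(** What is lost is [|y|^2] with [y = A z]. By Cauchy-Schwarz
    [|y|^4 = <z, A^T y>^2 <= |z|^2 |A^T y|^2], the spectral condition gives [|z|^2 <= (2n/k) |y|^2],
    and [A^T y = A^T x_S]. *)
Let capture_le : mxdot s (capture_mx S U X *m s) <= sqn r.
Proof.
rewrite capture_mx_form -/x -/xS -/k -/A sqn_r lerB// normal_eq.
set y := A *m z; set t := sqn (A^T *m y).
have ty : sqn y ^+ 2 <= sqn z * t.
  by have := mxdot_CS z (A^T *m y); rewrite -mxdotMl.
have y0 : 0 <= sqn y := sqn_ge0 _.
have t0 : 0 <= t := sqn_ge0 _.
have kn : 0 < 2 * n%:R / k by rewrite divr_gt0// mulr_gt0.
have zy : sqn z <= 2 * n%:R / k * sqn y.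
  rewrite -[2 * n%:R / k]invrK ler_pdivlMl ?invr_gt0//.
  by rewrite [(2 * n%:R / k)^-1]invfM invrK mulrC mulrA mulrC mulrA;
    have := sqn_z_le; rewrite -/y invfM; lra.
have [->|yn0] := eqVneq (sqn y) 0; first by rewrite mulr_ge0// ltW.
have yp : 0 < sqn y by rewrite lt0r yn0.
rewrite -(ler_pM2l yp) -expr2 (le_trans ty)//.
by apply: le_trans (ler_wpM2r t0 zy) _; rewrite mulrAC mulrCA mulrA mulrAC.
Qed.

Let g := Num.sqrt kappa * (eps * Num.sqrt eps).

Let kappa_ge0 : 0 <= kappa. Proof. exact: le_trans ler01 kappa_ge1. Qed.

Let g_ge0 : 0 <= g. Proof. by rewrite !mulr_ge0 ?sqrtr_ge0. Qed.

(** The source of the power 3/2. As [r] is orthogonal to [p], [|r|^2 = <v, r>], so the difference is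
    the product of [Ubar^T r] and [Ubar^T (p - v)]. The former equals [X^T r], of order [eps |s|];
    the latter is of order [sqrt (kappa eps) |s|]. Finally [3 <= (7/4)^2]. *)
Let cross_error : `|mxdot (Ubar^T *m (U *m w)) (Ubar^T *m r) - sqn r| <=
  7 / 4 * g * sqn s.
Proof.
have Ur : U^T *m r = 0 := residual_orth wopt.
have sqn_rE : sqn r = mxdot (Ubar^T *m v) (Ubar^T *m r).
  have vE : rows_in S v = xS - A *m z + A *m w.
    by rewrite -rS -rows_inM; apply/matrixP => i j; rewrite !mxE subrK.
  rewrite mulmxA BB mul1mx -mxdotMl [RHS]/mxdot residual_trM.
  rewrite -[RHS]/(mxdot (rows_in S v) (rows_in S (v - U *m w))) rS vE.
  have orth : mxdot (xS - A *m z) (A *m w) = 0.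
    by rewrite mxdotC mxdotMl mulmxBr normal_eq subrr /mxdot mulmx0 mxtrace0.
  by rewrite mxdotC mxdotDr orth addr0 sqn_residual rS.
have BrX : Ubar^T *m r = X^T *m r.
  rewrite /orth_compl [(_ - _)^T]linearB /= mulmxBl.
  by rewrite !trmx_mul trmxK -!mulmxA Ur !mulmx0 subr0.
rewrite {}sqn_rE mxdotC [X in _ - X]mxdotC -mxdotBr -mulmxBr.
have pv : sqn (U *m w - v) <= 3 * kappa * (eps * sqn s).
  rewrite -opprB sqnN diffE sqnB (sqn_isom z UU) [mxdot x _]mxdotC mxdotMl Ux.
  rewrite /mxdot mulmx0 mxtrace0 mulr0 subr0.
  have es : 0 <= eps * sqn s by rewrite mulr_ge0 ?sqn_ge0.
  have := ler_wpM2r es kappa_ge1; have := sqn_z_le'; have := sqn_x_le; lra.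
have Br : sqn (Ubar^T *m r) <= eps * (eps * sqn s).
  rewrite BrX (le_trans (sqnM _ _))// sqnT -subspace_errE// ler_wpM2l//.
have := mxdot_CS (Ubar^T *m r) (Ubar^T *m (U *m w - v)).
set e := mxdot _ _ => e2.
have {}e2 : e ^+ 2 <= (7 / 4 * g * sqn s) ^+ 2.
  apply: le_trans e2 _.
  have Bpv : sqn (Ubar^T *m (U *m w - v)) <= 3 * kappa * (eps * sqn s).
    by apply: le_trans pv; apply: sqn_trM_le.
  apply: le_trans (ler_pM (sqn_ge0 _) (sqn_ge0 _) Br Bpv) _.
  have -> : (7 / 4 * g * sqn s) ^+ 2 = 49 / 16 * (g ^+ 2 * sqn s ^+ 2) by field.
  have -> : g ^+ 2 = kappa * eps ^+ 3.
    by rewrite /g !exprMn !sqr_sqrtr//; ring.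
  have -> : eps * (eps * sqn s) * (3 * kappa * (eps * sqn s)) =
    3 * (kappa * eps ^+ 3 * sqn s ^+ 2) by ring.
  have : 0 <= kappa * eps ^+ 3 * sqn s ^+ 2.
    apply: mulr_ge0; last exact: exprn_ge0 (sqn_ge0 _).
    by apply: mulr_ge0 => //; apply: exprn_ge0.
  by move: (kappa * _ * _) => t t0; lra.
have gs : 0 <= 7 / 4 * g * sqn s by rewrite !mulr_ge0 ?sqn_ge0.
by rewrite -(@ler_pXn2r _ 2%N) ?nnegrE// real_normK ?num_real.
Qed.

Hypothesis theta_itv : 0 <= theta <= trigo.pi / 2.
Hypothesis sin_theta : sin theta = l2norm r / l2norm (U *m w).

(* With [p = U w] and [sin theta = |r| / |p|], the new direction is
   [(cos theta *: p + r) / |p|]. *)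
Lemma grouse_step_err_le :
  subspace_err Ubar (grouse_update U w r sigma eta) <=
  eps - 64 / 81 * Num.max 0 (mxdot s (capture_mx S U X *m s) / sqn s)
      + 10 * (Num.sqrt kappa * (eps * Num.sqrt eps)).
Proof.
rewrite -/g; have /andP[p_lo p_hi] := sqn_fit_bounds.
have Ur : U^T *m r = 0 := residual_orth wopt; have sin_th := sin_theta.
have [s0|sn0] := eqVneq (sqn s) 0.
  have w0 : w = 0.
    apply/eqP; rewrite -sqn_eq0 -(sqn_isom w UU); apply/eqP/le_anti.
    by rewrite sqn_ge0 andbT (le_trans p_hi)// s0 mulr0.
  rewrite grouse_update0// s0 invr0 mulr0 maxxx mulr0 subr0 lerDl.
  by rewrite mulr_ge0.
have s_gt0 : 0 < sqn s by rewrite lt0r sn0 sqn_ge0.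
set p := U *m w in p_lo p_hi sin_th Ur *; set P2 := sqn p in p_lo p_hi *.
have P2_gt0 : 0 < P2 by apply: lt_le_trans p_lo; rewrite mulr_gt0.
have wn0 : w != 0 by rewrite -sqn_eq0 -(sqn_isom w UU) gt_eqF.
have r0 : r = 0 -> sin theta = 0.
  by move=> r0; rewrite sin_th r0 l2normE sqn0 sqrtr0 mul0r.
rewrite grouse_update_err//.
have lw : l2norm w = l2norm p by rewrite !l2normE /p sqn_isom.
have lp2 : l2norm p ^+ 2 = P2 by rewrite l2norm_sqr.
have lp_gt0 : 0 < l2norm p by rewrite l2normE sqrtr_gt0.
have sin_r : sin theta *: ((l2norm r)^-1 *: r) = (l2norm p)^-1 *: r.
  rewrite sin_th scalerA; have [->|rn0] := eqVneq r 0; first by rewrite !scaler0.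
  by rewrite mulrAC divff ?mul1r// l2norm_eq0.
rewrite sin_r lw -!scalemxAr -/p.
rewrite scalerA [cos _ * _]mulrC -scalerA -scalerDr -!scalemxAr !sqnZ exprVn lp2.
have cc : cos theta ^+ 2 = 1 - sqn r / P2.
  have := cos2Dsin2 theta; rewrite sin_th expr_div_n l2norm_sqr lp2.
  by move=> /(canRL (addrK _)).
rewrite mulmxDr -scalemxAr sqnD sqnZ mxdotC mxdotZr [mxdot (Ubar^T *m r) _]mxdotC.
have := cross_error; rewrite -/p; set m := mxdot _ _; set R2 := sqn r in cc *.
set a := sqn (Ubar^T *m p); set b := sqn (Ubar^T *m r); set c := cos theta in cc *.
rewrite ler_norml => /andP[e_lo e_hi].
have a_le : a <= P2 by apply: sqn_trM_le.
have b_ge0 : 0 <= b := sqn_ge0 _.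
have R2_ge0 : 0 <= R2 := sqn_ge0 _.
have c_ge0 : 0 <= c.
  apply: cos_ge0_pihalf; have /andP[t0 ->] := theta_itv; rewrite andbT.
  by apply: le_trans t0; rewrite oppr_le0 divr_ge0 ?pi_ge0.
have c_le1 : c <= 1 by apply: cos_le1.
have E_ge0 : 0 <= 7 / 4 * g * sqn s by rewrite !mulr_ge0 ?sqn_ge0.
set E := 7 / 4 * g * sqn s in e_lo e_hi E_ge0.
set rho := R2 / P2 in cc.
have rho_ge0 : 0 <= rho by rewrite divr_ge0 ?sqn_ge0.
have R2E : R2 = rho * P2 by rewrite /rho divfK ?gt_eqF.
(* Shrinking the old direction loses [rho a <= R2], the cross term gains [2 c m]. Replacing [m] by
   [R2] costs [E], and [c >= c^2 = 1 - rho], so a net gain of [R2] remains to first order. *)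
have num : a - (c ^+ 2 * a + 2 * (c * m) + b) <= P2 * (- rho + 2 * rho ^+ 2) + 2 * E.
  have h1 : rho * a <= rho * P2 by rewrite ler_wpM2l.
  have h2 : c ^+ 2 * R2 <= c * R2.
    by rewrite ler_wpM2r// expr2 ler_piMl.
  have h3 : c * (R2 - m) <= E.
    have [h|h] := leP 0 (R2 - m).
      by apply: le_trans (_ : 1 * (R2 - m) <= _); [rewrite ler_wpM2r|lra].
    by apply: le_trans E_ge0; rewrite mulr_ge0_le0// ltW.
  rewrite cc R2E in h1 h2 h3 *; lra.
have rho_le : rho <= 16 / 9 * eps.
  rewrite /rho ler_pdivrMr// (le_trans sqn_r_le)//.
  have := ler_wpM2l eps_ge0 p_lo; lra.
have g_ge : eps ^+ 2 <= g / 11.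
  have es : Num.sqrt eps <= 1 / 11.
    rewrite -(@ler_pXn2r _ 2%N) ?nnegrE ?sqrtr_ge0// sqr_sqrtr//.
    by apply: le_trans eps_le _; rewrite !expr2; lra.
  have k1 : 1 <= Num.sqrt kappa by rewrite -[X in X <= _]sqrtr1 ler_wsqrtr.
  have e0 : 0 <= eps * Num.sqrt eps by rewrite mulr_ge0 ?sqrtr_ge0.
  have -> : eps ^+ 2 = (eps * Num.sqrt eps) * Num.sqrt eps.
    by rewrite -mulrA -[Num.sqrt eps * _]expr2 sqr_sqrtr.
  have := ler_wpM2l e0 es; have := ler_wpM2r e0 k1; rewrite -/g; lra.
(* [2 (7/4) / (9/16) = 56/9]; with the unit allotted to [rho2] the sum stays below 10. *)
have E_le : 2 * E / P2 <= 56 / 9 * g.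
  rewrite ler_pdivrMr// /E; have := ler_wpM2l g_ge0 p_lo; lra.
have rho2 : 2 * rho ^+ 2 <= g.
  have rho2 : rho ^+ 2 <= (16 / 9 * eps) ^+ 2.
    by rewrite ler_pXn2r// nnegrE mulr_ge0.
  have e : (16 / 9 * eps) ^+ 2 = 256 / 81 * eps ^+ 2 by field.
  rewrite e in rho2; have g0 := g_ge0; lra.
(* The alternative 0 serves the samples that satisfy the spectral condition without being
   [concentrated]. *)
have max_le : 64 / 81 * Num.max 0 (mxdot s (capture_mx S U X *m s) / sqn s) <= rho.
  have lb t : t <= R2 -> 64 / 81 * (t / sqn s) <= rho.
    move=> tR; have [t0|t0] := leP t 0.
      by apply: le_trans rho_ge0; rewrite mulr_ge0_le0// mulr_le0_ge0 ?invr_ge0 ?sqn_ge0.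
    rewrite /rho ler_pdivlMr//.
    have -> : 64 / 81 * (t / sqn s) * P2 = t * (P2 / (81 / 64 * sqn s)).
      by field; rewrite gt_eqF.
    apply: le_trans tR; apply: ler_piMr; first exact: ltW.
    by rewrite ler_pdivrMr ?mulr_gt0// mul1r.
  rewrite maxr_pMr//; rewrite ge_max mulr0 rho_ge0 /=.
  by apply: lb; apply: capture_le.
have -> : eps + P2^-1 * a - P2^-1 * (c ^+ 2 * a + 2 * (c * m) + b) =
    eps + (a - (c ^+ 2 * a + 2 * (c * m) + b)) / P2 by ring.
have : (a - (c ^+ 2 * a + 2 * (c * m) + b)) / P2 <= - rho + 2 * rho ^+ 2 + 2 * E / P2.
  have -> : - rho + 2 * rho ^+ 2 + 2 * E / P2 =
      (P2 * (- rho + 2 * rho ^+ 2) + 2 * E) / P2.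
    by rewrite [RHS]mulrDl; congr (_ + _); rewrite [RHS]mulrC mulKf ?gt_eqF.
  by rewrite ler_wpM2r// invr_ge0 ltW.
by have g0 := g_ge0; lra.
Qed.

End GrouseStepBound.

(** * Numerical bounds and the choice of the moment order *)

Section Numerics.
Context {R : realType}.

(** [expR (1/8) <= 1 / (1 - 1/8) = 8/7], and [(8/7)^8 < 3]. *)
Lemma expR1_le3 : expR 1 <= 3 :> R.
Proof.
have -> : expR 1 = expR (8^-1) ^+ 8 :> R by rewrite -expRM_natl divff.
have h : expR (8^-1) <= 8 / 7 :> R.
  have := expR_ge1Dx (- 8^-1 : R); rewrite expRN => h.
  rewrite -[expR _]invrK -[8 / 7]invrK lef_pV2 ?posrE ?invr_gt0 ?expR_gt0//.
  by apply: le_trans h; lra.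
apply: le_trans (_ : (8 / 7) ^+ 8 <= _).
  by rewrite ler_pXn2r ?nnegrE ?expR_ge0//; lra.
rewrite !exprS expr0; lra.
Qed.

Lemma natr_le_ln (m x : nat) : (3 ^ m <= x)%N -> m%:R <= ln x%:R :> R.
Proof.
move=> mx; rewrite -[m%:R](@expRK R) ler_ln ?posrE ?expR_gt0//; last first.
  by rewrite ltr0n (leq_trans _ mx)// expn_gt0.
apply: le_trans (_ : (3 ^ m)%N%:R <= _); last by rewrite ler_nat.
rewrite -[m%:R]mulr1 expRM_natl natrX.
by apply: lerXn2r; rewrite ?nnegrE ?expR_ge0 ?expR1_le3.
Qed.

Lemma ln20_ge : 5 / 2 <= ln 20 :> R.
Proof.
have := @natr_le_ln 5 400 isT.
have -> : 400%:R = 20 * 20 :> R by rewrite -natrM.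
by rewrite lnM ?posrE//; lra.
Qed.

Lemma half_le_ln2 : 1 / 2 <= ln 2 :> R.
Proof.
have := @natr_le_ln 1 4 isT.
have -> : 4%:R = 2 * 2 :> R by rewrite -natrM.
by rewrite lnM ?posrE//; lra.
Qed.

(* The sampling condition forces [n] to be large, by bootstrapping: a lower
   bound for [ln n] improves the lower bound for [n]. *)
Lemma ln_ge6 (n : nat) : (2 <= n)%N -> 160 / 3 * ln n%:R ^+ 2 <= n%:R :> R ->
  6 <= ln n%:R :> R.
Proof.
move=> n2 hn.
have step (a : R) (m : nat) (b : nat) : 0 <= a -> a <= ln n%:R ->
    (3 ^ m <= b.+1)%N -> b%:R < 160 / 3 * a ^+ 2 -> m%:R <= ln n%:R :> R.
  move=> a0 aln mb h; apply: natr_le_ln; apply: leq_trans mb _.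
  rewrite -(ltr_nat R); apply: lt_le_trans h _; apply: le_trans hn.
  by rewrite ler_wpM2l// ler_pXn2r// nnegrE (le_trans a0).
have l0 : 1 / 2 <= ln n%:R :> R.
  by apply: le_trans half_le_ln2 _; rewrite ler_ln ?posrE ?ltr0n ?ler_nat// (leq_trans _ n2).
(* The integers 8, 80 and 728 are [3^m - 1] for [m = 2, 4, 6]: exceeding one of them means reaching
   the power of 3. *)
have l1 : 2%:R <= ln n%:R :> R by apply: (@step (1 / 2) 2%N 8%N) => //; lra.
have l2 : 4%:R <= ln n%:R :> R by apply: (@step 2 4%N 80%N) => //; lra.
by apply: (@step 4 6%N 728%N) => //; lra.
Qed.

(** The factor [17/8] comes from the row bound on the iterates. The margin is thin: [ln n >= 6]
    gives [(160/3) 6 = 320] against [150 (17/8) = 318.75]. *)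
Lemma choose_moment (n d : nat) (q coh : R) :
  (1 <= d)%N -> (2 <= n)%N -> 1 <= coh -> q <= n%:R ->
  64 / 3 * ln n%:R ^+ 2 * d%:R * coh * ln (20 * d%:R) <= q ->
  exists P : nat, [/\ (0 < P)%N,
    150 * (17 / 8 * (d%:R / n%:R) * coh) * n%:R * P%:R <= q &
    d%:R * 3^-1 ^+ P <= q / (4 * n%:R)].
Proof.
move=> d1 n2 coh1 qn hq.
have n0 : 0 < n%:R :> R by rewrite ltr0n (leq_trans _ n2).
have dr1 : 1 <= d%:R :> R by rewrite ler1n.
set l := ln n%:R in hq.
have ln20 : 5 / 2 <= ln (20 * d%:R) :> R.
  by apply: le_trans ln20_ge _; rewrite ler_ln ?posrE ?mulr_gt0 ?ltr0n// ler_peMr.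
have dc1 : 1 <= d%:R * coh by rewrite -[X in X <= _]mulr1 ler_pM.
have q_ge : 160 / 3 * (l ^+ 2 * (d%:R * coh)) <= q.
  apply: le_trans hq.
  have -> : 64 / 3 * l ^+ 2 * d%:R * coh * ln (20 * d%:R) =
    64 / 3 * (l ^+ 2 * (d%:R * coh)) * ln (20 * d%:R) by ring.
  have e : 160 / 3 * (l ^+ 2 * (d%:R * coh)) = 64 / 3 * (l ^+ 2 * (d%:R * coh)) * (5 / 2) by lra.
  rewrite e; apply: ler_wpM2l => //.
  by rewrite mulr_ge0// mulr_ge0 ?sqr_ge0// (le_trans ler01).
have l6 : 6 <= l.
  apply: ln_ge6 => //; apply: le_trans qn; apply: le_trans q_ge.
  by rewrite ler_wpM2l// ler_peMr ?sqr_ge0.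
have l_ge0 : 0 <= l by apply: le_trans l6.
have /andP[Pl lP] := truncn_itv l_ge0; set P := Num.truncn l in Pl lP.
have lP' : l <= P%:R + 1 by rewrite natr1 ltW.
exists P; split.
- by rewrite -(ltr_nat R); lra.
- have -> : 150 * (17 / 8 * (d%:R / n%:R) * coh) * n%:R * P%:R =
    150 * 17 / 8 * (d%:R * coh) * P%:R by field; rewrite gt_eqF.
  apply: le_trans q_ge.
  apply: le_trans (_ : 150 * 17 / 8 * (d%:R * coh) * l <= _).
    by rewrite ler_wpM2l// !mulr_ge0// (le_trans ler01).
  have -> : 160 / 3 * (l ^+ 2 * (d%:R * coh)) = 160 / 3 * (d%:R * coh) * l * l by ring.
  rewrite ler_wpM2r//.
  have := ler_wpM2l (le_trans ler01 dc1) l6; lra.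
have e3 : 3^-1 ^+ P <= 3 / n%:R :> R.
  rewrite exprVn -[3 / _]invrK lef_pV2 ?posrE ?exprn_gt0 ?invr_gt0 ?divr_gt0//.
  rewrite invf_div ler_pdivrMr// -exprSr.
  rewrite -[n%:R](@lnK R) ?posrE// -/l.
  apply: le_trans (_ : expR (P.+1)%:R <= _); first by rewrite ler_expR -natr1.
  rewrite -[(P.+1)%:R]mulr1 expRM_natl.
  by apply: lerXn2r; rewrite ?nnegrE ?expR_ge0 ?expR1_le3.
apply: le_trans (_ : d%:R * (3 / n%:R) <= _); first by rewrite ler_wpM2l.
rewrite ler_pdivlMr ?mulr_gt0//.
have -> : d%:R * (3 / n%:R) * (4 * n%:R) = 12 * d%:R :> R by field; rewrite gt_eqF.
apply: le_trans q_ge.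
have l2 : 36 <= l ^+ 2.
  by rewrite (_ : 36 = 6 ^+ 2) ?ler_pXn2r ?nnegrE//; lra.
have dc : d%:R <= d%:R * coh by rewrite ler_peMr.
apply: le_trans (_ : 160 / 3 * (36 * d%:R) <= _).
  by move: (d%:R) dr1 => D D1; lra.
by rewrite ler_wpM2l// ler_pM.
Qed.

End Numerics.

(** * Expectations of bounded measurable functions *)

Section BoundedExpectation.
Context {d0 : measure_display} {T : measurableType d0} {R : realType}.
Variable P : probability T R.
Implicit Types f g : T -> R.

(** Entries of orthonormal matrices and of directions are bounded, so integrability reduces to
    closure properties of this class. *)
Definition bmf f : Prop := measurable_fun setT f /\ exists K, forall x, `|f x| <= K.

Lemma bmf_integrable f : bmf f -> P.-integrable setT (EFin \o f).
Proof.
move=> [mf [K fK]]; apply: measurable_bounded_integrable => //.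
  exact: le_lt_trans (probability_le1 P measurableT) (ltry _).
exists K; split; first exact: num_real.
by move=> M KM x _ /=; apply: le_trans (fK x) (ltW KM).
Qed.

Lemma bmf_cst c : bmf (fun=> c).
Proof. by split; [exact: measurable_cst|exists `|c|]. Qed.

Lemma bmfD f g : bmf f -> bmf g -> bmf (fun x => f x + g x).
Proof.
move=> [mf [K fK]] [mg [L gL]]; split; first exact: measurable_funD.
by exists (K + L) => x; rewrite (le_trans (ler_normD _ _))// lerD.
Qed.

Lemma bmfM f g : bmf f -> bmf g -> bmf (fun x => f x * g x).
Proof.
move=> [mf [K fK]] [mg [L gL]]; split; first exact: measurable_funM.
by exists (K * L) => x; rewrite normrM ler_pM.
Qed.

Lemma bmfN f : bmf f -> bmf (fun x => - f x).
Proof.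
move=> [mf [K fK]]; split; first exact: measurable_funN.
by exists K => x; rewrite normrN.
Qed.

Lemma bmf_sum (I : Type) (s : seq I) (p : pred I) (h : I -> T -> R) :
  (forall i, bmf (h i)) -> bmf (fun x => \sum_(i <- s | p i) h i x).
Proof.
move=> hb; elim: s => [|i s ih].
  by rewrite (_ : (fun _ => _) = fun=> 0); [exact: bmf_cst|apply/funext => x; rewrite big_nil].
rewrite (_ : (fun _ => _) = fun x => (if p i then h i x else 0) + \sum_(j <- s | p j) h j x).
  by apply: bmfD => //; case: (p i) => //; apply: bmf_cst.
by apply/funext => x; rewrite big_cons; case: (p i); rewrite ?add0r.
Qed.

Lemma bmf_indic (A : set T) : measurable A -> bmf (\1_A : T -> R).
Proof.
move=> mA; split; first exact: measurable_indic.
by exists 1 => x; rewrite indicE; case: (_ \in _); rewrite ?normr1 ?normr0.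
Qed.

Lemma bmf_bool (b : T -> bool) : measurable_fun setT b -> bmf (fun x => (b x)%:R).
Proof.
move=> mb; split; last first.
  by exists 1 => x; case: (b x); rewrite ?normr1 ?normr0.
rewrite (_ : (fun _ => _) = fun x => if b x then 1 else 0).
  by apply: measurable_fun_ifT => //; apply: measurable_cst.
by apply/funext => x; case: (b x).
Qed.

Local Notation E f := (Rintegral P setT f).

Lemma RexpD f g : bmf f -> bmf g -> E (fun x => f x + g x) = E f + E g.
Proof. by move=> bf bg; rewrite RintegralD//; apply: bmf_integrable. Qed.

Lemma RexpZ c f : bmf f -> E (fun x => c * f x) = c * E f.
Proof. by move=> bf; rewrite RintegralZl//; apply: bmf_integrable. Qed.

Lemma Rexp_cst c : E (fun=> c) = c.
Proof.
rewrite Rintegral_cst//.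
by rewrite -[RHS]mulr1; congr (c * _); apply: (congr1 fine (probability_setT P)).
Qed.

Lemma Rexp_le f g : bmf f -> bmf g -> (forall x, f x <= g x) -> E f <= E g.
Proof. by move=> bf bg fg; apply: le_Rintegral => //; apply: bmf_integrable. Qed.

Lemma Rexp_sum (I : Type) (s : seq I) (p : pred I) (h : I -> T -> R) :
  (forall i, bmf (h i)) ->
  E (fun x => \sum_(i <- s | p i) h i x) = \sum_(i <- s | p i) E (h i).
Proof.
move=> hb; elim: s => [|i s ih].
  rewrite big_nil -[RHS](Rexp_cst 0); congr Rintegral.
  by apply/funext => x; rewrite big_nil.
rewrite big_cons -ih; case: ifP => pi.
  rewrite -RexpD//; last exact: bmf_sum.
  by congr Rintegral; apply/funext => x; rewrite big_cons pi.
by congr Rintegral; apply/funext => x; rewrite big_cons pi.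
Qed.

Lemma Rexp_indic (A : set T) : measurable A -> E \1_A = fine (P A).
Proof. by move=> mA; rewrite /Rintegral integral_indic// setIT. Qed.

Lemma Rintegral_indic_mul (A : set T) f :
  Rintegral P A f = E (fun x => \1_A x * f x).
Proof.
rewrite Rintegral_mkcond; congr Rintegral; apply/funext => x.
by rewrite patchE indicE; case: ifP => xA; rewrite ?mul1r ?mul0r.
Qed.

End BoundedExpectation.

(** * Independence and products of expectations *)

Section Independence.
Context {d0 : measure_display} {T : measurableType d0} {R : realType}.
Variable P : probability T R.

(** For fixed [A], both sides are finite measures in [B] that agree on a generating pi-system. *)
Lemma independent_generated (A : set T) (G : set (set T)) :
  measurable A -> G `<=` measurable -> setI_closed G -> G setT ->
  (forall B, G B -> P (A `&` B) = (P A * P B)%E) ->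
  forall B, <<s G >> B -> P (A `&` B) = (P A * P B)%E.
Proof.
move=> mA Gm GI GT PG B GB.
have PA0 : 0 <= fine (P A) by rewrite fine_ge0.
have PAE : P A = (fine (P A))%:E by rewrite fineK// fin_num_measure.
rewrite setIC PAE.
rewrite -[LHS]/(mrestr P mA B) -[RHS]/(mscale (NngNum PA0) P B).
apply: (g_sigma_algebra_measure_unique G Gm (fun=> setT)) => //.
- by rewrite -subTset => x _; exists 0%N.
- by move=> C GC; rewrite /= /mrestr /mscale /= -PAE setIC PG.
- by move=> _; rewrite /= /mrestr setTI (le_lt_trans (probability_le1 P mA)) ?ltry.
Qed.

Variables G1 G2 : set (set T).
Hypothesis G1m : G1 `<=` measurable.
Hypothesis G2m : G2 `<=` measurable.
Hypothesis indep : forall A B, <<s G1 >> A -> <<s G2 >> B ->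
  P (A `&` B) = (P A * P B)%E.

Definition Gmeasurable (G : set (set T)) (f : T -> R) : Prop :=
  measurable_fun (setT : set (g_sigma_algebraType G)) f.

Lemma Gmeasurable_sub G f : G `<=` measurable -> Gmeasurable G f ->
  measurable_fun setT f.
Proof.
move=> Gm mf _ B mB; have := mf measurableT B mB.
apply: (smallest_sub (sigma_algebra_measurable T)).
  exact: Gm.
Qed.

(** Independence says that the diagonal map into [T1 * T2], two copies of [T] with the two
    sigma-algebras, sends [P] to a product measure; Fubini then applies. *)
Lemma Rexp_indep (f g : T -> R) : Gmeasurable G1 f -> Gmeasurable G2 g ->
  bmf f -> bmf g ->
  Rintegral P setT (fun x => f x * g x) = Rintegral P setT f * Rintegral P setT g.
Proof.
move=> mf mg bf bg.
pose T1 := g_sigma_algebraType G1; pose T2 := g_sigma_algebraType G2.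
have subm (G : set (set T)) : G `<=` measurable -> <<s G >> `<=` measurable.
  by move=> Gm; apply: (smallest_sub (sigma_algebra_measurable T)).
have mid1 : measurable_fun setT (fun x : T => x : T1).
  by move=> _ B mB; rewrite setTI; apply: (subm _ G1m).
have mid2 : measurable_fun setT (fun x : T => x : T2).
  by move=> _ B mB; rewrite setTI; apply: (subm _ G2m).
have mdiag : measurable_fun setT (fun x : T => (x : T1, x : T2)).
  exact: measurable_fun_pair.
pose X1 : {mfun T >-> T1} := HB.pack (fun x : T => x : T1) (isMeasurableFun.Build _ _ _ _ _ mid1).
pose X2 : {mfun T >-> T2} := HB.pack (fun x : T => x : T2) (isMeasurableFun.Build _ _ _ _ _ mid2).
pose X : {mfun T >-> (T1 * T2)%type} :=
  HB.pack (fun x : T => (x : T1, x : T2)) (isMeasurableFun.Build _ _ _ _ _ mdiag).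
pose m1 := distribution P X1; pose m2 := distribution P X2; pose m := distribution P X.
have mE : forall Z, measurable Z -> (m1 \x m2)%E Z = m Z.
  apply: product_measure_unique => A B mA mB; exact: indep.
have mfg : measurable_fun setT (fun z : T1 * T2 => f z.1 * g z.2).
  by apply: measurable_funM; apply: measurableT_comp.
have ifg : P.-integrable setT (EFin \o (fun x => f x * g x)).
  exact/bmf_integrable/bmfM.
have Em (h : (T1 * T2)%type -> \bar R) : measurable_fun setT h ->
    P.-integrable setT (h \o X) -> (\int[m]_z h z = \int[P]_x h (X x))%E.
  by move=> mh ih; rewrite integral_distribution.
have step : (\int[m1 \x m2]_z (f z.1 * g z.2)%:E = \int[P]_x (f x * g x)%:E)%E.
  rewrite -(Em (fun z => (f z.1 * g z.2)%:E))//; last exact/measurable_EFinP.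
  by apply: eq_measure_integral => A mA _; apply: mE.
have i12 : (m1 \x m2)%E.-integrable setT (fun z : T1 * T2 => (f z.1 * g z.2)%:E).
  have [_ [K fK]] := bf; have [_ [L gL]] := bg.
  apply: (measurable_bounded_integrable (f := fun z : T1 * T2 => f z.1 * g z.2)) => //.
    rewrite [X in (X < _)%E](mE _ measurableT).
    exact: le_lt_trans (probability_le1 m measurableT) (ltry _).
  exists (K * L); split; first exact: num_real.
  move=> M KM z _ /=; rewrite normrM; apply: le_trans (ltW KM).
  by apply: ler_pM.
rewrite {1}/Rintegral -step -(integral12_prod_meas1 i12).
have E1 (h : T1 -> R) : measurable_fun setT h -> @bmf _ T R h ->
    (\int[m1]_x (h x)%:E = (@Rintegral _ T R P setT h)%:E)%E.
  move=> mh bh; have ih := @bmf_integrable _ T R P _ bh.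
  rewrite /m1 integral_distribution//; last exact/measurable_EFinP.
  by rewrite /Rintegral fineK// integrable_fin_num.
have E2 (h : T2 -> R) : measurable_fun setT h -> @bmf _ T R h ->
    (\int[m2]_x (h x)%:E = (@Rintegral _ T R P setT h)%:E)%E.
  move=> mh bh; have ih := @bmf_integrable _ T R P _ bh.
  rewrite /m2 integral_distribution//; last exact/measurable_EFinP.
  by rewrite /Rintegral fineK// integrable_fin_num.
have i2 : m2.-integrable setT (EFin \o (g : T2 -> R)).
  have [_ [L gL]] := bg; apply: measurable_bounded_integrable => //.
    exact: le_lt_trans (probability_le1 m2 measurableT) (ltry _).
  exists L; split; first exact: num_real.
  by move=> M LM z _ /=; apply: le_trans (gL _) (ltW LM).
have -> : (\int[m1]_x \int[m2]_y (f (x, y).1 * g (x, y).2)%:E =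
    \int[m1]_x ((Rintegral P setT g * f x)%:E))%E.
  apply: eq_integral => x _ /=; under eq_integral do rewrite EFinM.
  by rewrite integralZl// E2// -EFinM mulrC.
rewrite E1//=.
- by rewrite RexpZ// mulrC.
- by apply: measurable_funM => //; exact: measurable_cst.
- by apply: bmfM => //; exact: bmf_cst.
Qed.

End Independence.

(** * The standard normal law is symmetric and has no atom *)

Section NormalSymmetry.
Context {R : realType}.
Local Notation mu := (@lebesgue_measure R).

Lemma lebesgue_measure_oppr (A : set R) : measurable A ->
  mu (-%R @^-1` A) = mu A.
Proof.
move=> mA; apply/esym.
have mN : measurable_fun setT (-%R : measurableTypeR R -> measurableTypeR R).
  exact: oppr_measurable.
rewrite -[RHS]/(pushforward mu (-%R : measurableTypeR R -> measurableTypeR R) A).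
pose N : {mfun measurableTypeR R >-> measurableTypeR R} :=
  HB.pack (-%R : measurableTypeR R -> measurableTypeR R) (isMeasurableFun.Build _ _ _ _ _ mN).
apply: (@lebesgue_measure_unique R (pushforward mu N)) => //.
move=> _ [[a b] _ <-] /=; rewrite /pushforward /=.
have -> : -%R @^-1` `]a, b] = [set` `[(- b), (- a)[] :> set R.
  by apply/seteqP; split => x /=; rewrite !in_itv /= lerNl ltrNr andbC.
by rewrite !lebesgue_measure_itv /= !lte_fin ltrN2 opprK addeC.
Qed.

Lemma normal_prob_oppr (A : set R) : measurable A ->
  normal_prob (0 : R) (1 : R) (-%R @^-1` A) = normal_prob (0 : R) (1 : R) A.
Proof.
move=> mA; rewrite /normal_prob.
have mN : measurable_fun setT (-%R : measurableTypeR R -> measurableTypeR R).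
  exact: oppr_measurable.
pose N : {mfun measurableTypeR R >-> measurableTypeR R} :=
  HB.pack (-%R : measurableTypeR R -> measurableTypeR R) (isMeasurableFun.Build _ _ _ _ _ mN).
transitivity (\int[pushforward mu N]_(x in A) (normal_pdf 0 1 x)%:E)%E; last first.
  by apply: eq_measure_integral => B mB _; apply: lebesgue_measure_oppr.
rewrite ge0_integral_pushforward//.
- apply: eq_integral => x _ /=.
  by rewrite /normal_pdf /= oner_eq0 /normal_fun !subr0 sqrrN.
- by apply/measurable_EFinP; apply: measurable_funTS; apply: measurable_normal_pdf.
- by move=> x _; rewrite lee_fin normal_pdf_ge0.
Qed.

Lemma normal_prob_set1 (a : R) : normal_prob (0 : R) (1 : R) [set a] = 0%E.
Proof.
by have /null_content_dominatesP := normal_prob_dominates (0 : R) 1; apply => //;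
  apply: lebesgue_measure_set1.
Qed.

End NormalSymmetry.

(** * Second moments of the direction of a Gaussian vector *)

Section GaussianDirection.
Context {d0 : measure_display} {T : measurableType d0} {R : realType}.
Variable P : probability T R.
Variables (d : nat).

Definition box (B : 'I_d -> set R) : set 'cV[R]_d := [set v | forall k, B k (v k 0)].

(** The pi-system on which the law of independent coordinates is a product; it generates the
    sigma-algebra put on column vectors. *)
Definition boxes : set (set 'cV[R]_d) :=
  [set C | exists2 B : 'I_d -> set R, (forall k, measurable (B k)) & C = box B].

Lemma boxes_setI : setI_closed boxes.
Proof.
move=> _ _ [B mB ->] [C mC ->]; exists (fun k => B k `&` C k).
  by move=> k; apply: measurableI.
by apply/seteqP; split=> [v [vB vC] k|v vBC]; [split|split=> k; have [] := vBC k].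
Qed.

Lemma boxes_setT : boxes setT.
Proof. by exists (fun=> setT) => //; apply/seteqP; split. Qed.

Local Notation V := (g_sigma_algebraType boxes).

Lemma measurable_coord k : measurable_fun setT (fun v : V => (v : 'cV[R]_d) k 0).
Proof.
move=> _ B mB; rewrite setTI; apply: sub_sigma_algebra.
exists (fun j => if j == k then B else setT) => [j|]; first by case: ifP.
apply/seteqP; split => [v vB j|v /(_ k)]; last by rewrite eqxx.
by case: eqP => // ->.
Qed.

Lemma measurable_to_boxes (S : T -> 'cV[R]_d) :
  (forall k, measurable_fun setT (fun x => S x k 0)) ->
  measurable_fun setT (S : T -> V).
Proof.
move=> mS; apply: (@measurability _ _ T V setT S boxes) => // _ [_ [B mB ->] <-].
rewrite setTI (_ : _ @^-1` _ = \bigcap_(k in [set: 'I_d]) ((fun x => S x k 0) @^-1` B k)).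
  apply: fin_bigcap_measurable => [|k _]; first exact: finite_finset.
  by rewrite -[X in measurable X]setTI; apply: mS.
by apply/seteqP; split=> x /= h k; [move=> _|]; apply: h.
Qed.

(** An entry of the orthogonal projector on the line of [v], and 0 when [v = 0]. *)
Definition direction (i j : 'I_d) (v : 'cV[R]_d) : R := v i 0 * v j 0 / sqn v.

Lemma direction_le1 i j v : `|direction i j v| <= 1.
Proof.
have sqn_ge (k : 'I_d) : v k 0 ^+ 2 <= sqn v.
  rewrite sqnE (bigD1 k)//= big_ord1 lerDl; apply: sumr_ge0 => l _.
  by rewrite big_ord1 sqr_ge0.
have [v0|vn0] := eqVneq (sqn v) 0; first by rewrite /direction v0 invr0 mulr0 normr0.
have v_gt0 : 0 < sqn v by rewrite lt0r vn0 sqn_ge0.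
rewrite /direction normrM normfV (ger0_norm (ltW v_gt0)) ler_pdivrMr// mul1r.
have hi := sqn_ge i; have hj := sqn_ge j.
rewrite ler_norml; apply/andP; split.
  by have := sqr_ge0 (v i 0 + v j 0); rewrite sqrrD; lra.
by have := sqr_ge0 (v i 0 - v j 0); rewrite sqrrB; lra.
Qed.

Lemma measurable_direction i j : measurable_fun setT (direction i j : V -> R).
Proof.
rewrite (_ : direction i j = fun v => v i 0 * v j 0 * (sqn v `^ (-1))); last first.
  by apply/funext => v; rewrite powR_inv1 ?sqn_ge0.
apply: measurable_funM.
  by apply: measurable_funM; apply: measurable_coord.
apply: (measurableT_comp (@measurable_powR R (-1))).
apply: (eq_measurable_fun (fun v : V => \sum_k ((v : 'cV[R]_d) k 0) ^+ 2)).
  by move=> v _; rewrite sqnE; apply: eq_bigr => k _; rewrite big_ord1.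
by apply: measurable_sum => k; apply: measurable_funX; apply: measurable_coord.
Qed.

Lemma eq_law_Rexp (S1 S2 : T -> 'cV[R]_d) (f : 'cV[R]_d -> R) :
  (forall k, measurable_fun setT (fun x => S1 x k 0)) ->
  (forall k, measurable_fun setT (fun x => S2 x k 0)) ->
  (forall B, (forall k, measurable (B k)) ->
     P (S1 @^-1` box B) = P (S2 @^-1` box B)) ->
  measurable_fun setT (f : V -> R) -> (exists K, forall v, `|f v| <= K) ->
  Rintegral P setT (fun x => f (S1 x)) = Rintegral P setT (fun x => f (S2 x)).
Proof.
move=> cS1 cS2 eqS mf [K fK].
have mS1 := measurable_to_boxes cS1; have mS2 := measurable_to_boxes cS2.
pose X1 : {mfun T >-> V} := HB.pack (S1 : T -> V) (isMeasurableFun.Build _ _ _ _ _ mS1).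
pose X2 : {mfun T >-> V} := HB.pack (S2 : T -> V) (isMeasurableFun.Build _ _ _ _ _ mS2).
have EX (X : {mfun T >-> V}) : (\int[distribution P X]_v (f v)%:E = \int[P]_x (f (X x))%:E)%E.
  rewrite (integral_distribution (f := EFin \o (f : V -> R)))//.
    exact/measurable_EFinP.
  apply: (@bmf_integrable _ _ _ P (fun x => f (X x))).
  by split; [exact: (measurableT_comp mf)|exists K].
rewrite /Rintegral; congr fine; rewrite -(EX X1) -(EX X2).
apply: eq_measure_integral => A mA _.
apply: (@measure_unique _ _ V boxes (fun=> setT) _ _ _ _
  (distribution P X1) (distribution P X2)) => //.
- exact: boxes_setI.
- by move=> _; apply: boxes_setT.
- by rewrite -subTset => x _; exists 0%N.
- by move=> _ [B mB ->]; apply: eqS.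
- by move=> _; apply: le_lt_trans (probability_le1 _ measurableT) (ltry _).
Qed.

Section StandardGaussian.
Variable s : 'I_d -> T -> R.
Hypothesis ms : forall k, measurable_fun setT (s k).
Hypothesis sN : forall k (B : set R), measurable B ->
  P (s k @^-1` B) = normal_prob (0 : R) (1 : R) B.
Hypothesis s_indep : forall B : 'I_d -> set R, (forall k, measurable (B k)) ->
  P (\bigcap_(k in [set: 'I_d]) (s k @^-1` B k)) = (\prod_(k < d) P (s k @^-1` B k))%E.

Let S (x : T) : 'cV[R]_d := \col_k s k x.

Let cS k : measurable_fun setT (fun x => S x k 0).
Proof. by rewrite (_ : (fun _ => _) = s k)//; apply/funext => x; rewrite mxE. Qed.

Let PS B : (forall k, measurable (B k)) ->
  P (S @^-1` box B) = (\prod_(k < d) normal_prob (0 : R) (1 : R) (B k))%E.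
Proof.
move=> mB; rewrite -(eq_bigr _ (fun k _ => sN k (mB k))) -s_indep//; congr (P _).
by apply/seteqP; split => x /= h k; [move=> _|]; have := h k; rewrite mxE//; apply.
Qed.

Lemma bmf_direction i j : bmf (fun x => direction i j (S x)).
Proof.
split; last by exists 1 => x; apply: direction_le1.
exact: measurableT_comp (measurable_direction i j) (measurable_to_boxes cS).
Qed.

(* Flipping the sign of one coordinate preserves the law. *)
Lemma Rexp_direction_neq i j : i != j ->
  Rintegral P setT (fun x => direction i j (S x)) = 0.
Proof.
move=> ij; pose S' (x : T) : 'cV[R]_d := \col_k (if k == i then - s k x else s k x).
have cS' k : measurable_fun setT (fun x => S' x k 0).
  rewrite (_ : (fun _ => _) = if k == i then (fun x => - s k x) else s k).
    by case: ifP => // _; apply: measurable_funN.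
  by apply/funext => x; rewrite mxE; case: ifP.
have h : Rintegral P setT (fun x => direction i j (S x)) =
         Rintegral P setT (fun x => direction i j (S' x)).
  apply: eq_law_Rexp => //; last 2 first.
  - exact: measurable_direction.
  - by exists 1 => v; apply: direction_le1.
  move=> B mB; rewrite PS//; pose B' k := if k == i then -%R @^-1` B k else B k.
  have mN (C : set R) : measurable C -> measurable (-%R @^-1` C).
    by move=> mC; rewrite -[X in measurable X]setTI; apply: oppr_measurable.
  have mB' k : measurable (B' k) by rewrite /B'; case: ifP => // _; apply: mN.
  transitivity (P (S @^-1` box B')).
    rewrite PS//; apply: eq_bigr => k _; rewrite /B'; case: ifP => // _.
    by rewrite normal_prob_oppr.
  congr (P _); apply/seteqP; split => x /= xB k; have := xB k; rewrite /B' !mxE;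
    by case: ifP.
have hN x : direction i j (S' x) = (-1) * direction i j (S x).
  rewrite /direction !mxE eqxx eq_sym (negbTE ij) !mulNr mul1r; congr (- (_ / _)).
  rewrite !sqnE; apply: eq_bigr => k _; rewrite !big_ord1 !mxE.
  by case: ifP => // _; rewrite sqrrN.
move: h; under [in RHS]eq_Rintegral do rewrite hN.
by rewrite RexpZ; [lra|exact: bmf_direction].
Qed.

Let Rexp_direction_swap i j :
  Rintegral P setT (fun x => direction i i (S x)) =
  Rintegral P setT (fun x => direction j j (S x)).
Proof.
pose S' (x : T) : 'cV[R]_d := \col_k s (tperm i j k) x.
have cS' k : measurable_fun setT (fun x => S' x k 0).
  by rewrite (_ : (fun _ => _) = s (tperm i j k))//; apply/funext => x; rewrite mxE.
have -> : Rintegral P setT (fun x => direction i i (S x)) =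
          Rintegral P setT (fun x => direction i i (S' x)).
  apply: eq_law_Rexp => //; last 2 first.
  - exact: measurable_direction.
  - by exists 1 => v; apply: direction_le1.
  move=> B mB; rewrite PS//.
  transitivity (P (S @^-1` box (fun k => B (tperm i j k)))).
    rewrite PS//; exact: (reindex_inj (@perm_inj _ (tperm i j))).
  congr (P _); apply/seteqP; split => x /= xB k; have := xB (tperm i j k);
    by rewrite !mxE ?tpermK.
congr Rintegral; apply/funext => x; rewrite /direction !mxE tpermL; congr (_ / _).
rewrite !sqnE (reindex_inj (@perm_inj _ (tperm i j))); apply: eq_bigr => k _.
by rewrite !big_ord1 !mxE tpermK.
Qed.

(** The diagonal entries have equal means by exchangeability, and they sum to 1 almost surely. *)
Lemma Rexp_direction_eq i : Rintegral P setT (fun x => direction i i (S x)) = d%:R^-1.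
Proof.
have d_gt0 : 0 < d%:R :> R by rewrite ltr0n (leq_ltn_trans _ (ltn_ord i)).
pose Z := s i @^-1` [set 0].
have mZ : measurable Z.
  by rewrite -[Z]setTI; apply: ms => //; apply: measurable_set1.
have bd j : bmf (fun x => direction j j (S x)) by apply: bmf_direction.
have sum1 : \sum_j Rintegral P setT (fun x => direction j j (S x)) = 1.
  rewrite -Rexp_sum//.
  (* The sum is 1 unless the vector vanishes, which happens inside the null event [Z]. *)
  have lo : 1 <= Rintegral P setT (fun x => \sum_j direction j j (S x)).
    have bZ : bmf (fun x => (-1) * \1_Z x : R).
      by apply: bmfM; [exact: bmf_cst|exact: bmf_indic].
    have <- : Rintegral P setT (fun x => 1 + (-1) * \1_Z x) = 1.
      rewrite RexpD//; last exact: bmf_cst.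
      rewrite RexpZ; last exact: bmf_indic.
      rewrite Rexp_cst Rexp_indic// /Z sN; last exact: measurable_set1.
      by rewrite normal_prob_set1 mulr0 addr0.
    apply: Rexp_le; [by apply: bmfD => //; exact: bmf_cst|exact: bmf_sum|].
    move=> x; rewrite /direction -mulr_suml.
    have -> : \sum_j S x j 0 * S x j 0 = sqn (S x).
      by rewrite sqnE; apply: eq_bigr => j _; rewrite big_ord1 expr2.
    have [S0|Sn0] := eqVneq (S x) 0.
      rewrite S0 sqn0 mul0r indicE mem_set ?mulr1 ?subrr// /Z /=.
      by have := congr1 (fun v : 'cV[R]_d => v i 0) S0; rewrite !mxE.
    rewrite divff ?sqn_eq0// gerDl mulN1r oppr_le0 indicE; exact: ler0n.
  apply/le_anti; rewrite lo andbT -[X in _ <= X](Rexp_cst P 1).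
  apply: Rexp_le; [exact: bmf_sum|exact: bmf_cst|move=> x].
  rewrite /direction -mulr_suml.
  have -> : \sum_j S x j 0 * S x j 0 = sqn (S x).
    by rewrite sqnE; apply: eq_bigr => j _; rewrite big_ord1 expr2.
  have [->|Sn0] := eqVneq (sqn (S x)) 0; first by rewrite mul0r.
  by rewrite divff.
have : Rintegral P setT (fun x => direction i i (S x)) * d%:R = 1.
  rewrite -[RHS]sum1 (eq_bigr _ (fun j _ => Rexp_direction_swap j i)).
  by rewrite sumr_const card_ord mulr_natr.
by move=> /(canRL (mulfK (lt0r_neq0 d_gt0))) ->; rewrite mul1r.
Qed.

End StandardGaussian.
End GaussianDirection.

(** * Coherence and row norms *)

Section Coherence.
Context {R : realType}.
Variables n d : nat.
Hypothesis d_gt0 : (0 < d)%N.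
Hypothesis n_gt0 : (0 < n)%N.

Lemma sqn_row_le_coherence (U : 'M[R]_(n, d)) i :
  sqn (row i U) <= d%:R / n%:R * coherence U.
Proof.
have dn0 : d%:R / n%:R * (n%:R / d%:R) = 1 :> R by field; rewrite !pnatr_eq0 -!lt0n n_gt0 d_gt0.
by rewrite /coherence mulrA dn0 mul1r -l2norm_sqr; apply: le_bigmax.
Qed.

Lemma coherence_ge1 (U : 'M[R]_(n, d)) : orthonormal_cols U -> 1 <= coherence U.
Proof.
move=> UU; have n0 : 0 < n%:R :> R by rewrite ltr0n.
have dr0 : 0 < d%:R :> R by rewrite ltr0n.
rewrite -(ler_pM2l dr0) mulr1 -{1}(sqn_orthonormal UU) sqn_rows.
apply: le_trans (_ : \sum_(i < n) d%:R / n%:R * coherence U <= _).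
  by apply: ler_sum => i _; apply: sqn_row_le_coherence.
rewrite sumr_const card_ord -mulr_natl le_eqVlt; apply/orP; left; apply/eqP.
by field; rewrite gt_eqF.
Qed.

End Coherence.

(** * Swap invariance of the sampling law *)

Section SamplingLaw.
Context {d0 : measure_display} {T : measurableType d0} {R : realType}.
Variable P : probability T R.

(** Composing a sequence of draws with the transposition is an involution that swaps its set of
    values. *)
Lemma replacement_prob_swap n N i j (S : {set 'I_n}) :
  replacement_prob N (swap i j S) = replacement_prob N S :> R.
Proof.
rewrite /replacement_prob; congr (_%:R / _).
pose h (f : {ffun 'I_N -> 'I_n}) := [ffun k => tperm i j (f k)].
have hK : involutive h by move=> f; apply/ffunP => k; rewrite !ffunE tpermK.
rewrite -!sum1_card (reindex_inj (inv_inj hK)); apply: eq_bigl => f; rewrite !inE.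
have -> : h f @: 'I_N = swap i j (f @: 'I_N).
  by rewrite /swap -imset_comp; apply: eq_imset => k; rewrite /= ffunE.
exact: (inj_eq (can_inj (@swapK _ i j))).
Qed.

Variables (n N : nat) (q : R) (Om : T -> {set 'I_n}).
Hypothesis mOm : forall S, measurable (Om @^-1` [set S]).
Hypothesis drawn : drawn_with_replacement P N q Om.
Hypothesis large : {ae P, forall x, q <= #|Om x|%:R}.

Definition set_prob (S : {set 'I_n}) : R := fine (P (Om @^-1` [set S])).

Lemma set_prob_ge0 S : 0 <= set_prob S. Proof. exact: fine_ge0. Qed.

Lemma set_prob_large S : set_prob S != 0 -> q <= #|S|%:R.
Proof.
apply: contraNT; rewrite -ltNge => Sq; rewrite /set_prob.
have -> // : P (Om @^-1` [set S]) = 0%E.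
apply: measure_negligible => //; apply: negligibleS large => x /= ->.
by apply/negP; rewrite -ltNge.
Qed.

Lemma set_prob_swap i j S : set_prob (swap i j S) = set_prob S.
Proof.
have cardE : #|swap i j S| = #|S| by rewrite /swap card_imset//; apply: perm_inj.
have [qS|Sq] := leP q #|S|%:R.
  rewrite /set_prob drawn ?cardE// drawn// replacement_prob_swap.
  by [].
have zero (S' : {set 'I_n}) : #|S'| = #|S| -> set_prob S' = 0.
  move=> S'S; apply/eqP/negPn/negP => /set_prob_large; rewrite S'S.
  by apply/negP; rewrite -ltNge.
by rewrite !zero.
Qed.

Lemma sum_set_indic (f : {set 'I_n} -> R) x :
  \sum_S \1_(Om @^-1` [set S]) x * f S = f (Om x).
Proof.
rewrite (bigD1 (Om x))//= big1 ?addr0; last first.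
  move=> S SO; rewrite indicE memNset ?mul0r// => /= E.
  by rewrite E eqxx in SO.
by rewrite indicE mem_set ?mul1r.
Qed.

Lemma sum_set_prob : \sum_S set_prob S = 1.
Proof.
transitivity (\sum_(S : {set 'I_n}) Rintegral P setT (\1_(Om @^-1` [set S]) : T -> R)).
  by apply: eq_bigr => S _; rewrite Rexp_indic.
rewrite -(Rexp_sum P _ _ (fun S => bmf_indic (mOm S))) -[RHS](Rexp_cst P).
congr Rintegral; apply/funext => x; rewrite -[RHS](sum_set_indic (fun=> 1) x).
by apply: eq_bigr => S _; rewrite mulr1.
Qed.

End SamplingLaw.

(** * Closure properties of bounded measurable matrices *)

Section BoundedMatrices.
Context {d0 : measure_display} {T : measurableType d0} {R : realType}.

Definition bmx m p (M : T -> 'M[R]_(m, p)) : Prop := forall i j, bmf (fun x => M x i j).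

Lemma bmx_cst m p (A : 'M[R]_(m, p)) : bmx (fun=> A).
Proof. by move=> i j; apply: bmf_cst. Qed.

Lemma bmxM m p q (M : T -> 'M[R]_(m, p)) (N : T -> 'M[R]_(p, q)) :
  bmx M -> bmx N -> bmx (fun x => M x *m N x).
Proof.
move=> bM bN i j; rewrite (_ : (fun _ => _) = fun x => \sum_k M x i k * N x k j).
  by apply: bmf_sum => k; apply: bmfM.
by apply/funext => x; rewrite mxE.
Qed.

Lemma bmxB m p (M N : T -> 'M[R]_(m, p)) : bmx M -> bmx N -> bmx (fun x => M x - N x).
Proof.
move=> bM bN i j; rewrite (_ : (fun _ => _) = fun x => M x i j + - N x i j).
  by apply: bmfD => //; apply: bmfN.
by apply/funext => x; rewrite !mxE.
Qed.

Lemma bmxZ m p a (M : T -> 'M[R]_(m, p)) : bmx M -> bmx (fun x => a *: M x).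
Proof.
move=> bM i j; rewrite (_ : (fun _ => _) = fun x => a * M x i j).
  by apply: bmfM => //; apply: bmf_cst.
by apply/funext => x; rewrite !mxE.
Qed.

Lemma bmx_tr m p (M : T -> 'M[R]_(m, p)) : bmx M -> bmx (fun x => (M x)^T).
Proof.
move=> bM i j; rewrite (_ : (fun _ => _) = fun x => M x j i)//.
by apply/funext => x; rewrite mxE.
Qed.

Lemma bmx_rows_in m p (S : {set 'I_m}) (M : T -> 'M[R]_(m, p)) :
  bmx M -> bmx (fun x => rows_in S (M x)).
Proof.
move=> bM i j; rewrite (_ : (fun _ => _) = fun x => M x (enum_val i) j)//.
by apply/funext => x; rewrite mxE.
Qed.

Lemma bmx_exp m k (M : T -> 'M[R]_m) : bmx M -> bmx (fun x => M x ^+ k).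
Proof.
move=> bM; elim: k => [|k ih].
  by rewrite (_ : (fun _ => _) = fun=> 1)//; exact: bmx_cst.
rewrite (_ : (fun _ => _) = fun x => M x *m M x ^+ k); first exact: bmxM.
by apply/funext => x; rewrite exprS.
Qed.

Lemma bmf_sqn m p (M : T -> 'M[R]_(m, p)) : bmx M -> bmf (fun x => sqn (M x)).
Proof.
move=> bM; rewrite (_ : (fun _ => _) = fun x => \sum_i \sum_j M x i j * M x i j).
  by apply: bmf_sum => i; apply: bmf_sum => j; apply: bmfM.
by apply/funext => x; rewrite sqnE; apply: eq_bigr => i _; apply: eq_bigr => j _; rewrite expr2.
Qed.

Lemma bmf_concentrated n d k (S : {set 'I_n}) (M : T -> 'M[R]_(n, d)) :
  bmx M -> bmf (fun x => (concentrated k S (M x))%:R : R).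
Proof.
move=> bM; apply: bmf_bool; apply: measurable_fun_ler; last exact: measurable_cst.
apply: (proj1 (bmf_sqn _)); apply: bmx_exp; apply: bmxB; last exact: bmx_cst.
by apply: bmxM; [apply: bmx_tr|]; apply: bmx_rows_in.
Qed.

Lemma bmx_capture n d (S : {set 'I_n}) (M : T -> 'M[R]_(n, d)) (B : 'M[R]_(n, d)) :
  bmx M -> bmx (fun x => capture_mx S (M x) (orth_compl (M x) B)).
Proof.
move=> bM; have bX : bmx (fun x => orth_compl (M x) B).
  by apply: bmxB; [exact: bmx_cst|apply: bmxM; [apply: bmxM => //; exact: bmx_tr|exact: bmx_cst]].
have bU := bmx_rows_in (S := S) bM; have bXS := bmx_rows_in (S := S) bX.
apply: bmxB; first by apply: bmxM => //; apply: bmx_tr.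
by apply: bmxZ; apply: bmxM; apply: bmxM => //; apply: bmx_tr.
Qed.

Lemma bmf_subspace_err n d (M : T -> 'M[R]_(n, d)) (B : 'M[R]_(n, d)) :
  bmx M -> bmf (fun x => subspace_err B (M x)).
Proof.
move=> bM; rewrite (_ : (fun _ => _) = fun x => d%:R + - sqn (B^T *m M x)).
  apply: bmfD; first exact: bmf_cst.
  by apply: bmfN; apply: bmf_sqn; apply: bmxM => //; apply: bmx_cst.
by apply/funext => x; rewrite /subspace_err l2norm_sqr.
Qed.

Lemma bmx_orthonormal n d (M : T -> 'M[R]_(n, d)) :
  (forall i j, measurable_fun setT (fun x => M x i j)) ->
  (forall x, orthonormal_cols (M x)) -> bmx M.
Proof.
move=> mM oM i j; split => //; exists (1 + d%:R) => x.
have h : `|M x i j| ^+ 2 <= d%:R.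
  rewrite real_normK ?num_real// -(sqn_orthonormal (oM x)) sqnE.
  rewrite (bigD1 i)//= (bigD1 j)//= -addrA lerDl addr_ge0//.
    by apply: sumr_ge0 => k _; apply: sqr_ge0.
  by apply: sumr_ge0 => k _; apply: sumr_ge0 => l _; apply: sqr_ge0.
have := sqr_ge0 (1 - `|M x i j|); rewrite sqrrB; have := normr_ge0 (M x i j).
rewrite expr1n mul1r; lra.
Qed.

End BoundedMatrices.

(** * Orthonormality of the iterates and averaging over the fresh data *)

Section Run.
Context {R : realType} {d0 : measure_display} {T : measurableType d0}.
Variable P : probability T R.
Variables n d : nat.
Variable Ubar : 'M[R]_(n, d).
Variables (U : nat -> 'I_n -> 'I_d -> {RV P >-> R})
          (s : nat -> 'I_d -> {RV P >-> R})
          (Om : nat -> T -> {set 'I_n}).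

Section Orthonormality.
Variables (w : nat -> T -> 'cV[R]_d) (eta : nat -> T -> R) (N : nat -> nat) (q : R).
Hypothesis run : grouse_run U s Om w eta Ubar N q.

Lemma iterate_orthonormal t x : orthonormal_cols (iterate U t x).
Proof.
elim: t => [|t ih]; first exact: (grouse_init run).
have [ws|nws] := pselect (well_sampled (Om t x) (iterate U t x)); last first.
  by rewrite (grouse_skip run nws).
rewrite (grouse_step run ws); apply: grouse_update_orthonormal => //.
  exact: residual_orth (grouse_lsq run ws).
(* A zero residual makes [sigma] zero, so the absent direction [r / |r|] has coefficient [sin 0]. *)
move=> r0; rewrite /step_sigma r0.
rewrite (_ : l2norm (0 : 'cV[R]_n) = 0) ?mul0r ?sin0//.
by apply/eqP; rewrite l2norm_eq0.
Qed.

End Orthonormality.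

Variable t : nat.
Hypothesis mOm : forall j S, measurable (Om j @^-1` [set S]).

Definition history_gen : set (set T) :=
  [set A | (exists j i k B, [/\ (j <= t)%N, measurable B & A = U j i k @^-1` B])
        \/ (exists j k B, [/\ (j < t)%N, measurable B & A = s j k @^-1` B])
        \/ (exists j E, (j < t)%N /\ A = Om j @^-1` E)].

Lemma measurable_sampling j (E : set {set 'I_n}) : measurable (Om j @^-1` E).
Proof.
rewrite (_ : _ @^-1` _ = \bigcup_(S in E) (Om j @^-1` [set S])).
  by apply: fin_bigcup_measurable => //; exact: finite_finset.
by apply/seteqP; split => [x xE|x [S ES /= ->]//]; exists (Om j x).
Qed.

Lemma history_gen_measurable : history_gen `<=` measurable.
Proof.
move=> A [[j [i [k [B [_ mB ->]]]]]|[[j [k [B [_ mB ->]]]]|[j [E [_ ->]]]]].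
- by rewrite -[X in measurable X]setTI; apply: measurable_funP.
- by rewrite -[X in measurable X]setTI; apply: measurable_funP.
- exact: measurable_sampling.
Qed.

Definition weight_boxes : set (set T) :=
  [set A | exists2 B : 'I_d -> set R, (forall k, measurable (B k)) &
     A = \bigcap_(k in [set: 'I_d]) (s t k @^-1` B k)].

Definition sampling_events : set (set T) := [set A | exists E, A = Om t @^-1` E].

Definition fresh_gen : set (set T) :=
  [set A | exists B E, [/\ weight_boxes B, sampling_events E & A = B `&` E]].

Lemma weight_boxes_measurable : weight_boxes `<=` measurable.
Proof.
move=> _ [B mB ->]; apply: fin_bigcap_measurable => [|k _]; first exact: finite_finset.
by rewrite -[X in measurable X]setTI; apply: measurable_funP.
Qed.

Lemma sampling_events_measurable : sampling_events `<=` measurable.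
Proof. by move=> _ [E ->]; apply: measurable_sampling. Qed.

Lemma fresh_gen_measurable : fresh_gen `<=` measurable.
Proof.
move=> _ [B [E [/weight_boxes_measurable mB /sampling_events_measurable mE ->]]].
exact: measurableI.
Qed.

Lemma weight_boxes_setI : setI_closed weight_boxes.
Proof.
move=> _ _ [B mB ->] [C mC ->]; exists (fun k => B k `&` C k).
  by move=> k; apply: measurableI.
by apply/seteqP; split=> [x [xB xC] k _|x xBC]; [split; [exact: xB|exact: xC]|
  split=> k _; have [] := xBC k Logic.I].
Qed.

Lemma weight_boxesT : weight_boxes setT.
Proof. by exists (fun=> setT) => //; apply/seteqP; split. Qed.

Lemma sampling_events_setI : setI_closed sampling_events.
Proof. by move=> _ _ [E ->] [F ->]; exists (E `&` F). Qed.

Lemma sampling_eventsT : sampling_events setT.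
Proof. by exists setT. Qed.

Lemma fresh_gen_setI : setI_closed fresh_gen.
Proof.
move=> _ _ [B [E [gB gE ->]]] [C [F [gC gF ->]]]; exists (B `&` C), (E `&` F).
split; [exact: weight_boxes_setI|exact: sampling_events_setI|].
by rewrite setIACA.
Qed.

Lemma fresh_genT : fresh_gen setT.
Proof.
by exists setT, setT; split; [exact: weight_boxesT|exact: sampling_eventsT|rewrite setIT].
Qed.

Hypothesis fresh : fresh_data U s Om t.

Let historyT : history U s Om t setT.
Proof. exact: (@measurableT _ (g_sigma_algebraType history_gen)). Qed.

Lemma weight_boxes_sampling_indep B E : weight_boxes B -> sampling_events E ->
  P (B `&` E) = (P B * P E)%E.
Proof.
move=> [C mC ->] [F ->].
have h1 := fresh F historyT mC; have h2 := fresh setT historyT mC.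
rewrite setTI in h1; rewrite setTI preimage_setT setIT in h2.
by rewrite h1 h2 probability_setT !mule1 !mul1e.
Qed.

Lemma weight_indep (B : 'I_d -> set R) : (forall k, measurable (B k)) ->
  P (\bigcap_(k in [set: 'I_d]) (s t k @^-1` B k)) = (\prod_(k < d) P (s t k @^-1` B k))%E.
Proof.
move=> mB; have := fresh setT historyT mB.
by rewrite setTI preimage_setT setIT probability_setT mule1 mul1e.
Qed.

Lemma history_fresh_indep A C : history U s Om t A -> <<s fresh_gen >> C ->
  P (A `&` C) = (P A * P C)%E.
Proof.
move=> hA; apply: independent_generated.
- apply: (smallest_sub (sigma_algebra_measurable T) _ hA).
  exact: history_gen_measurable.
- exact: fresh_gen_measurable.
- exact: fresh_gen_setI.
- exact: fresh_genT.
move=> _ [B [E [gB gE ->]]]; rewrite (weight_boxes_sampling_indep gB gE).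
have [C' mC' ->] := gB; have [F ->] := gE.
by rewrite setIA (fresh F hA mC') weight_indep// muleA.
Qed.

(** The product formula is extended from generators to sigma-algebras one side at a time. *)
Lemma weight_sampling_indep A C : <<s sampling_events >> A -> <<s weight_boxes >> C ->
  P (A `&` C) = (P A * P C)%E.
Proof.
move=> sA; apply: independent_generated.
- apply: (smallest_sub (sigma_algebra_measurable T) _ sA).
  exact: sampling_events_measurable.
- exact: weight_boxes_measurable.
- exact: weight_boxes_setI.
- exact: weight_boxesT.
move=> B gB; rewrite setIC muleC; move: sA; apply: independent_generated.
- exact: weight_boxes_measurable.
- exact: sampling_events_measurable.
- exact: sampling_events_setI.
- exact: sampling_eventsT.
by move=> E gE; apply: weight_boxes_sampling_indep.
Qed.

Lemma sub_Gmeasurable (G H : set (set T)) (f : T -> R) : G `<=` <<s H >> ->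
  Gmeasurable G f -> Gmeasurable H f.
Proof.
move=> GH mf _ B mB; have := mf measurableT B mB.
by apply: (smallest_sub (smallest_sigma_algebra setT H)).
Qed.

Lemma Gmeasurable_direction i j :
  Gmeasurable weight_boxes (fun x => direction i j (weights s t x)).
Proof.
have mw k : measurable_fun setT
    (fun x : g_sigma_algebraType weight_boxes => (weights s t x) k 0).
  move=> _ B mB; rewrite setTI; apply: sub_sigma_algebra.
  exists (fun k' => if k' == k then B else setT) => [k'|]; first by case: ifP.
  apply/seteqP; split => [x /= xB k' _|x /= /(_ k Logic.I)]; last by rewrite eqxx mxE.
  by move: xB; rewrite mxE; case: eqP => // ->.
exact: measurableT_comp (measurable_direction i j) (measurable_to_boxes mw).
Qed.

Lemma Gmeasurable_sampling (S : {set 'I_n}) :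
  Gmeasurable sampling_events (\1_(Om t @^-1` [set S]) : T -> R).
Proof.
apply: measurable_indic; apply: sub_sigma_algebra; by exists [set S].
Qed.

Hypothesis sN : forall k (B : set R), measurable B ->
  distribution P (s t k) B = normal_prob (0 : R) (1 : R) B.

Lemma weights_direction_bmf i j : bmf (fun x => direction i j (weights s t x)).
Proof. by apply: bmf_direction => k; apply: measurable_funP. Qed.

Lemma Rexp_weights_direction i j :
  Rintegral P setT (fun x => direction i j (weights s t x)) = (i == j)%:R * d%:R^-1.
Proof.
have ms k : measurable_fun setT (s t k) by apply: measurable_funP.
case: eqVneq => [->|ij]; rewrite ?mul1r ?mul0r.
  by apply: Rexp_direction_eq => //; exact: weight_indep.
by apply: Rexp_direction_neq => //; exact: weight_indep.
Qed.

Lemma Rexp_fresh (a : T -> R) (S : {set 'I_n}) i j : Gmeasurable history_gen a -> bmf a ->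
  Rintegral P setT (fun x => a x *
    (\1_(Om t @^-1` [set S]) x * direction i j (weights s t x))) =
  Rintegral P setT a * (set_prob P (Om t) S * ((i == j)%:R * d%:R^-1)).
Proof.
move=> ma ba.
have bS : bmf (\1_(Om t @^-1` [set S]) : T -> R) by apply: bmf_indic.
have bd := weights_direction_bmf i j.
rewrite (Rexp_indep history_gen_measurable fresh_gen_measurable)//; last 3 first.
- exact: history_fresh_indep.
- apply: measurable_funM.
    apply: sub_Gmeasurable (Gmeasurable_sampling S) => _ [E ->].
    apply: sub_sigma_algebra; exists setT, (Om t @^-1` E).
    by split; [exact: weight_boxesT|exists E|rewrite setTI].
  apply: sub_Gmeasurable (Gmeasurable_direction i j) => B gB.
  apply: sub_sigma_algebra; exists B, setT.
  by split => //; [exact: sampling_eventsT|rewrite setIT].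
- exact: bmfM.
rewrite (Rexp_indep sampling_events_measurable weight_boxes_measurable)//; last 3 first.
- exact: weight_sampling_indep.
- exact: Gmeasurable_sampling.
- exact: Gmeasurable_direction.
by rewrite Rexp_weights_direction Rexp_indic.
Qed.

Local Notation HT := (g_sigma_algebraType history_gen).

Lemma bmf_history (f : T -> R) : @bmf _ HT R f -> bmf f.
Proof.
by move=> [mf bf]; split => //; exact: (Gmeasurable_sub history_gen_measurable mf).
Qed.

(** Expanding over the values of the sample and the entries of [H] separates history, sample and
    direction; the off-diagonal means vanish, and a trace is left. *)
Lemma Rexp_quadratic (H : {set 'I_n} -> T -> 'M[R]_d) :
  (forall S, @bmx _ HT R _ _ (H S)) ->
  Rintegral P setT (fun x =>
    mxdot (weights s t x) (H (Om t x) x *m weights s t x) / sqn (weights s t x)) =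
  d%:R^-1 * Rintegral P setT (fun x => \sum_S set_prob P (Om t) S * \tr (H S x)).
Proof.
move=> bH.
have bHf S i j : bmf (fun x => H S x i j) by apply: bmf_history; apply: bH.
have bt S i j : bmf (fun x => H S x i j *
    (\1_(Om t @^-1` [set S]) x * direction i j (weights s t x))).
  by apply: bmfM => //; apply: bmfM; [exact: bmf_indic|exact: weights_direction_bmf].
transitivity (Rintegral P setT (fun x => \sum_(S : {set 'I_n}) \sum_i \sum_j H S x i j *
    (\1_(Om t @^-1` [set S]) x * direction i j (weights s t x)))).
  congr Rintegral; apply/funext => x.
  rewrite -[LHS](sum_set_indic (Om t) (fun S => mxdot (weights s t x)
    (H S x *m weights s t x) / sqn (weights s t x)) x).
  apply: eq_bigr => S _; rewrite /mxdot trace_mx11 mxE mulr_suml mulr_sumr.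
  apply: eq_bigr => i _; rewrite !mxE mulr_sumr mulr_suml mulr_sumr.
  by apply: eq_bigr => j _; rewrite /direction !mxE; ring.
rewrite Rexp_sum; last by move=> S; apply: bmf_sum => i; apply: bmf_sum.
rewrite Rexp_sum; last first.
  by move=> S; apply: bmfM; [exact: bmf_cst|apply: bmf_sum].
rewrite mulr_sumr; apply: eq_bigr => S _.
rewrite Rexp_sum; last by move=> i; apply: bmf_sum.
rewrite RexpZ; last exact: bmf_sum.
rewrite Rexp_sum// 2!mulr_sumr; apply: eq_bigr => i _; rewrite Rexp_sum//.
rewrite (bigD1 i)//= big1 ?addr0 => [|j ji]; rewrite Rexp_fresh//; last 3 first.
- exact: (proj1 (bH S i i)).
- by rewrite eq_sym (negbTE ji) mul0r !mulr0.
- exact: (proj1 (bH S i j)).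
by rewrite eqxx mul1r; ring.
Qed.

End Run.

(** * Expected decrease of the error on an event of the history *)

Section ExpectedDecrease.
Context {R : realType} {d0 : measure_display} {T : measurableType d0}.
Variable P : probability T R.
Variables n d : nat.
Hypothesis d_gt0 : (0 < d)%N.
Hypothesis n_ge : (2 * d <= n)%N.
Variable Ubar : 'M[R]_(n, d).
Hypothesis BB : orthonormal_cols Ubar.
Variables (U : nat -> 'I_n -> 'I_d -> {RV P >-> R})
          (s : nat -> 'I_d -> {RV P >-> R})
          (Om : nat -> T -> {set 'I_n})
          (w : nat -> T -> 'cV[R]_d) (eta : nat -> T -> R)
          (N : nat -> nat) (q : R).
Hypothesis run : grouse_run U s Om w eta Ubar N q.
Hypothesis sN : forall t k (B : set R), measurable B ->
  distribution P (s t k) B = normal_prob (0 : R) (1 : R) B.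
Hypothesis large : forall t, {ae P, forall x, q <= #|Om t x|%:R}.
Hypothesis q_ge : 64 / 3 * ln n%:R ^+ 2 * d%:R * coherence Ubar * ln (20 * d%:R) <= q.
Variable t : nat.
Hypothesis step_length : forall x, small_error Ubar q (error U Ubar t x) ->
  well_sampled (Om t x) (iterate U t x) ->
  sin (step_sigma U s Om w Ubar t x * eta t x) =
  l2norm (resid U s Om w Ubar t x) / l2norm (fit U w t x).

Local Notation HT := (g_sigma_algebraType (history_gen U s Om t)).
Local Notation e := (error U Ubar t).
Local Notation e' := (error U Ubar t.+1).
Local Notation mOm := (grouse_Om_measurable run).
Local Notation E f := (Rintegral P setT f).

Let oU := iterate_orthonormal run.

Let n_gt0 : (0 < n)%N. Proof. by lia. Qed.
Let n_ge2 : (2 <= n)%N. Proof. by lia. Qed.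

Lemma sample_bound_gt0 : 0 < q.
Proof.
apply: lt_le_trans q_ge; have coh1 := coherence_ge1 d_gt0 n_gt0 BB.
have dr : 1 <= d%:R :> R by rewrite ler1n.
move: (coherence Ubar) coh1 => c c1.
by rewrite !mulr_gt0 ?exprn_gt0 ?ln_gt0 ?ltr1n ?ltr0n//; lra.
Qed.
Local Notation q_gt0 := sample_bound_gt0.

(** Some set has positive probability, and its cardinality lies between [q] and [n]. *)
Lemma sample_bound_le : q <= n%:R.
Proof.
have [S S0|h] := pickP (fun S => set_prob P (Om t) S != 0).
  apply: le_trans (set_prob_large (mOm t) (large t) S0) _.
  by rewrite ler_nat -[leqRHS]card_ord max_card.
have := sum_set_prob P (mOm t); rewrite big1 => [/eqP|S _].
  by rewrite eq_sym oner_eq0.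
by apply/eqP/negPn; rewrite h.
Qed.

Lemma error_ge0 j x : 0 <= error U Ubar j x.
Proof. exact: subspace_err_ge0. Qed.

Lemma error_le j x : error U Ubar j x <= d%:R.
Proof. exact: subspace_err_le. Qed.

Lemma bmf_error j : bmf (error U Ubar j).
Proof.
apply: bmf_subspace_err; apply: bmx_orthonormal => // i k.
by under eq_fun do rewrite mxE; apply: measurable_funP.
Qed.

Let bmx_iterate : @bmx _ HT R _ _ (iterate U t).
Proof.
apply: bmx_orthonormal => // i k; under eq_fun do rewrite mxE.
move=> _ B mB; rewrite setTI; apply: sub_sigma_algebra; left.
by exists t, i, k, B.
Qed.

Lemma history_error : @bmf _ HT R e.
Proof. exact: bmf_subspace_err. Qed.

Lemma bmf_pow32 (f : T -> R) : (forall x, 0 <= f x) -> bmf f ->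
  bmf (fun x => f x * Num.sqrt (f x)).
Proof.
move=> f0 bf; apply: bmfM => //; split.
  rewrite (_ : (fun _ => _) = fun x => f x `^ 2^-1).
    exact: measurableT_comp (measurable_powR _) (proj1 bf).
  by apply/funext => x; rewrite powR12_sqrt.
have [_ [K fK]] := bf; exists (Num.sqrt K) => x.
rewrite ger0_norm ?sqrtr_ge0// ler_sqrt; last exact: le_trans (normr_ge0 _) (fK x).
exact: le_trans (ler_norm _) (fK x).
Qed.

Section OnEvent.
Variable A : set T.
Hypothesis hA : history U s Om t A.
Hypothesis A_small : forall x, A x -> small_error Ubar q (e x).

Let mA : measurable A.
Proof.
apply: (smallest_sub (sigma_algebra_measurable T) _ hA).
exact: history_gen_measurable mOm.
Qed.

Variable p : nat.
Hypothesis p_gt0 : (0 < p)%N.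
Hypothesis Lp : 150 * (17 / 8 * (d%:R / n%:R) * coherence Ubar) * n%:R * p%:R <= q.
Hypothesis dp : d%:R * 3^-1 ^+ p <= q / (4 * n%:R).

(* The factor [q <= |S|] discards a null event, on which the step bound may fail. *)
Let gate S x : R := (concentrated p S (iterate U t x))%:R * (q <= #|S|%:R)%R%:R * \1_A x.

Let gain S x : 'M[R]_d :=
  gate S x *: capture_mx S (iterate U t x) (orth_compl (iterate U t x) Ubar).

Let quad x : R :=
  mxdot (weights s t x) (gain (Om t x) x *m weights s t x) / sqn (weights s t x).

Let bound x : R := e x + 10 * (Num.sqrt (n%:R / q) * (e x * Num.sqrt (e x))).

Let bmx_gain S : @bmx _ HT R _ _ (gain S).
Proof.
move=> i j; have bc := bmx_capture S Ubar bmx_iterate.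
rewrite (_ : (fun _ => _) = fun x => gate S x *
    capture_mx S (iterate U t x) (orth_compl (iterate U t x) Ubar) i j); last first.
  by apply/funext => x; rewrite mxE.
apply: (@bmfM _ HT) => //; apply: (@bmfM _ HT); last exact: (@bmf_indic _ HT).
by apply: (@bmfM _ HT); [exact: (@bmf_concentrated _ HT)|exact: (@bmf_cst _ HT)].
Qed.

(** Valid at every point, with a measurable right-hand side in which [w] and [eta] no longer
    occur. *)
Let step_le x : \1_A x * e' x <=
  \1_A x * bound x + - (64 / 81) * quad x + d%:R * \1_[set x | #|Om t x|%:R < q] x.
Proof.
have bound_ge : e x <= bound x.
  by rewrite lerDl !mulr_ge0 ?sqrtr_ge0// error_ge0.
have [Ax|nAx] := boolP (x \in A); last first.
  rewrite /quad /gain /gate !indicE (negbTE nAx) mulr0 scale0r mul0mx.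
  rewrite /mxdot mulmx0 mxtrace0 !mul0r mulr0 !add0r.
  by rewrite mulr_ge0.
(* On too small a sample only the crude bound [e' <= d] is used; the last term of the statement pays
   for it. *)
have [qO|Oq] := leP q #|Om t x|%:R; last first.
  rewrite /quad /gain /gate !indicE Ax (lt_geF Oq) mulr0 mul0r scale0r mul0mx.
  rewrite /mxdot mulmx0 mxtrace0 !mul0r mulr0 !mul1r addr0 mem_set//= mulr1.
  by have := error_le t.+1 x; have := error_ge0 t x; lra.
have xsmall := A_small (set_mem Ax).
have quadE : quad x = (concentrated p (Om t x) (iterate U t x))%:R *
   (mxdot (weights s t x) (capture_mx (Om t x) (iterate U t x)
     (orth_compl (iterate U t x) Ubar) *m weights s t x) / sqn (weights s t x)).
  rewrite /quad /gain /gate indicE Ax qO !mulr1 -scalemxAl.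
  by rewrite /mxdot -scalemxAr mxtraceZ mulrA.
rewrite !indicE Ax !mul1r memNset ?mulr0 ?addr0; last by apply/negP; rewrite -leNgt.
(* Without the spectral condition no step is taken, and the gain vanishes too, since [concentrated]
   would imply that condition. *)
have [ws|nws] := pselect (well_sampled (Om t x) (iterate U t x)); last first.
  rewrite {1}/error (grouse_skip run nws) quadE (_ : concentrated _ _ _ = false).
    by rewrite mul0r mulr0 addr0.
  by apply/negP => /(concentrated_well_sampled p_gt0).
have [eta_gt0 theta_itv] := grouse_eta run ws.
have := grouse_step_err_le d_gt0 (oU t x) BB q_gt0 qO (proj1 xsmall) ws
  (grouse_lsq run ws) theta_itv (step_length xsmall ws).
rewrite -(grouse_step run ws) -/(error U Ubar t.+1 x) -/(error U Ubar t x) quadE.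
move=> h; apply: le_trans h _.
rewrite /bound addrAC mulNr lerD2l lerN2 ler_pM2l; last by lra.
by case: concentrated; rewrite ?mul1r ?mul0r ?le_max ?lexx ?orbT.
Qed.

(** Twice the row bound for [Ubar] plus twice the error, at most a sixteenth of that bound:
    [2 + 2/16 = 17/8]. *)
Let row_le x i : A x ->
  sqn (row i (iterate U t x)) <= 17 / 8 * (d%:R / n%:R) * coherence Ubar.
Proof.
move=> Ax; have := sqn_row_le_err i (oU t x) BB.
have := sqn_row_le_coherence d_gt0 n_gt0 Ubar i.
have := proj2 (A_small Ax); rewrite /error.
have -> : d%:R / (16 * n%:R) * coherence Ubar = (d%:R / n%:R * coherence Ubar) / 16.
  by field; rewrite pnatr_eq0 -lt0n n_gt0.
rewrite -mulrA; lra.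
Qed.

Let trace_gain_ge x : q / (2 * n%:R) * (\1_A x * e x) <=
  \sum_S set_prob P (Om t) S * \tr (gain S x).
Proof.
have [Ax|nAx] := boolP (x \in A); last first.
  rewrite indicE (negbTE nAx) mul0r mulr0 big1// => S _.
  by rewrite /gain /gate indicE (negbTE nAx) mulr0 scale0r mxtrace0 mulr0.
rewrite indicE Ax mul1r /error subspace_errE//.
have := @expected_capture R n d d p (set_prob P (Om t)) q _ (set_prob_ge0 P (Om t))
  (set_prob_swap (mOm t) (grouse_sampling run t) (large t))
  (set_prob_large (mOm t) (large t)) n_gt0 q_gt0 p_gt0 _ _ (oU t x)
  (trM_orth_compl Ubar (oU t x)) (fun i => row_le i (set_mem Ax)) Lp dp.
rewrite (sum_set_prob P (mOm t)) mulr1 => h; apply: le_trans h _; apply: ler_sum => S _.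
have [->|S0] := eqVneq (set_prob P (Om t) S) 0; first by rewrite !mul0r.
rewrite /gain /gate indicE Ax (set_prob_large (mOm t) (large t) S0) !mulr1.
rewrite mxtraceZ tr_capture_mx /capture.
by case: concentrated; rewrite ?mul1r ?mul0r.
Qed.

(** The coefficient is [64/81], times [1/d] from the Gaussian direction, times [q/(2n)] from the
    sample. *)
Lemma expected_error_event : E (fun x => \1_A x * e' x) <=
  E (fun x => \1_A x * (bound x - 32 / 81 * (q / (n%:R * d%:R)) * e x)).
Proof.
have bA : bmf (\1_A : T -> R) := bmf_indic mA.
have be := bmf_error t; have be' := bmf_error t.+1.
have bb : bmf bound.
  apply: bmfD => //; apply: bmfM; first exact: bmf_cst.
  by apply: bmfM; [exact: bmf_cst|apply: bmf_pow32 => // x; exact: error_ge0].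
have mbad : measurable [set x | #|Om t x|%:R < q].
  exact: (measurable_sampling mOm t [set S : {set 'I_n} | (#|S|%:R < q)%R]).
have Pbad : fine (P [set x | #|Om t x|%:R < q]) = 0.
  rewrite (_ : P _ = 0%E)//; apply: measure_negligible => //.
  by apply: negligibleS (large t) => x /=; rewrite ltNge => /negP.
have fresh : fresh_data U s Om t by exact: (grouse_fresh run).
have qE : E quad = d%:R^-1 * E (fun x => \sum_S set_prob P (Om t) S * \tr (gain S x)).
  exact: (Rexp_quadratic mOm fresh (sN t) bmx_gain).
have bt : bmf (fun x => \sum_S set_prob P (Om t) S * \tr (gain S x)).
  apply: bmf_sum => S; apply: bmfM; first exact: bmf_cst.
  by apply: bmf_sum => i; apply: (bmf_history mOm); apply: bmx_gain.
have bq : bmf quad.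
  rewrite (_ : quad = fun x => \sum_S \1_(Om t @^-1` [set S]) x *
      (mxdot (weights s t x) (gain S x *m weights s t x) / sqn (weights s t x))); last first.
    by apply/funext => x; rewrite sum_set_indic.
  apply: bmf_sum => S; apply: bmfM; first by apply: bmf_indic; exact: mOm.
  rewrite (_ : (fun _ => _) = fun x => \sum_i \sum_j gain S x i j *
      direction i j (weights s t x)); last first.
    apply/funext => x; rewrite /mxdot trace_mx11 mxE mulr_suml; apply: eq_bigr => i _.
    rewrite !mxE mulr_sumr mulr_suml; apply: eq_bigr => j _.
    by rewrite /direction !mxE; ring.
  apply: bmf_sum => i; apply: bmf_sum => j; apply: bmfM.
    by apply: (bmf_history mOm); apply: bmx_gain.
  exact: weights_direction_bmf.
have b1 : bmf (fun x => \1_A x * bound x) by apply: bmfM.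
have b2 : bmf (fun x => - (64 / 81) * quad x) by apply: bmfM => //; exact: bmf_cst.
have b3 : bmf (fun x => d%:R * \1_[set x | #|Om t x|%:R < q] x : R).
  by apply: bmfM; [exact: bmf_cst|exact: bmf_indic].
have b4 : bmf (fun x => \1_A x * e x) by apply: bmfM.
have h1 := Rexp_le P (bmfM bA be') (bmfD (bmfD b1 b2) b3) step_le.
have h2 := Rexp_le P (bmfM (bmf_cst (q / (2 * n%:R))) b4) bt trace_gain_ge.
move: h1; rewrite RexpD ?RexpD//; [|exact: bmfD]; rewrite !RexpZ//; last exact: bmf_indic.
rewrite Rexp_indic// Pbad mulr0 addr0 => h1; apply: le_trans h1 _.
rewrite qE; rewrite RexpZ// in h2.
have -> : E (fun x => \1_A x * (bound x - 32 / 81 * (q / (n%:R * d%:R)) * e x)) =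
    E (fun x => \1_A x * bound x) + - (32 / 81 * (q / (n%:R * d%:R))) * E (fun x => \1_A x * e x).
  rewrite -RexpZ// -RexpD//; last by apply: bmfM => //; exact: bmf_cst.
  by congr Rintegral; apply/funext => x; ring.
rewrite lerD2l !mulNr lerN2.
have -> : 32 / 81 * (q / (n%:R * d%:R)) = 64 / 81 * (d%:R^-1 * (q / (2 * n%:R))) :> R.
  by field; rewrite !pnatr_eq0 -!lt0n d_gt0 n_gt0.
rewrite -(mulrA (64 / 81)) ler_pM2l; last by lra.
by rewrite -(mulrA d%:R^-1) ler_pM2l ?invr_gt0 ?ltr0n.
Qed.

End OnEvent.
End ExpectedDecrease.

(** * From an integral inequality to an almost sure one *)

Section AlmostSure.
Context {d0 : measure_display} {T : measurableType d0} {R : realType}.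
Variable P : probability T R.

Lemma ae_le_of_integral (A : set T) (f g : T -> R) : measurable A ->
  P.-integrable setT (EFin \o f) -> P.-integrable setT (EFin \o g) ->
  (forall x, A x -> g x < f x) ->
  Rintegral P A f <= Rintegral P A g -> {ae P, forall x, ~ A x}.
Proof.
move=> mA intf intg fg le_fg.
have iA h : P.-integrable setT (EFin \o h) -> P.-integrable A (EFin \o h).
  exact: integrableS.
have ifg : P.-integrable A (EFin \o (fun x => f x - g x)).
  exact: (integrableB mA (iA _ intf) (iA _ intg)).
have int0 : (\int[P]_(x in A) `|(f x - g x)%:E| = 0)%E.
  have -> : (\int[P]_(x in A) `|(f x - g x)%:E| = \int[P]_(x in A) (f x - g x)%:E)%E.
    apply: eq_integral => x /set_mem Ax; rewrite gee0_abs// lee_fin subr_ge0.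
    exact/ltW/fg.
  apply/eqP; rewrite eq_le; apply/andP; split; last first.
    by apply: integral_ge0 => x Ax; rewrite lee_fin subr_ge0 ltW// fg.
  rewrite -(fineK (integrable_fin_num mA ifg)) lee_fin.
  by rewrite -[leLHS]/(Rintegral P A _) RintegralB ?subr_le0//; exact: iA.
have /(ae_eq_integral_abs P mA) : measurable_fun A (EFin \o (fun x => f x - g x)).
  exact: measurable_int ifg.
move=> [/(_ int0) + _]; apply: filterS => x h Ax; have := h Ax.
by move=> [] /eqP; rewrite subr_eq0 => /eqP fgx; have := fg x Ax; rewrite fgx ltxx.
Qed.

End AlmostSure.

Theorem theorem2p14
  (R : realType) (d0 : measure_display) (T : measurableType d0)
  (P : probability T R)
  (n d : nat) (hd : (1 <= d)%N) (hn : (2 * d <= n)%N)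
  (Ubar : 'M[R]_(n, d)) (hUbar : orthonormal_cols Ubar)
  (U : nat -> 'I_n -> 'I_d -> {RV P >-> R})
  (s : nat -> 'I_d -> {RV P >-> R})
  (Om : nat -> T -> {set 'I_n})
  (w : nat -> T -> 'cV[R]_d) (eta : nat -> T -> R)
  (N : nat -> nat) (q C1 delta : R)
  (hrun : grouse_run U s Om w eta Ubar N q)
  (hs : forall t k (B : set R), measurable B ->
     distribution P (s t k) B = normal_prob (0 : R) (1 : R) B)
  (hOm : forall t, {ae P, forall x, q <= #|Om t x|%:R})
  (hC1 : 64 / 3 <= C1)
  (hq : C1 * ln n%:R ^+ 2 * d%:R * coherence Ubar * ln (20 * d%:R) <= q)
  (hdelta : 0 < delta < 6 / 10)
  (t : nat)
  (hstep : forall x, small_error Ubar q (error U Ubar t x) ->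
     well_sampled (Om t x) (iterate U t x) ->
     sin (step_sigma U s Om w Ubar t x * eta t x) =
     l2norm (resid U s Om w Ubar t x) / l2norm (fit U w t x))
  (hcoh : ((1 - delta)%:E <= P [set x |
     vcoherence (orth_part U s Ubar t x) <=
       ln n%:R * Num.sqrt ((45 / 1000) / ln 10 * C1 * d%:R * coherence Ubar
                           * ln (20 * d%:R)) /\
     vcoherence (orth_part U s Ubar t x) <=
       ln n%:R ^+ 2 * ((5 / 100) / (8 * ln 10) * C1 * ln (20 * d%:R))]%R)%E)
  (Y : T -> R)
  (hY : is_cond_exp P (sigma_of (error U Ubar t)) (error U Ubar t.+1) Y) :
  {ae P, forall x, small_error Ubar q (error U Ubar t x) ->
    Y x <= error U Ubar t x
           - (32 / 100) * (6 / 10 - delta) * (q / (n%:R * d%:R))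
             * error U Ubar t x
           + 55 * Num.sqrt (n%:R / q) * error U Ubar t x `^ (3 / 2)}.
Proof.
have n_ge2 : (2 <= n)%N by lia.
have n_gt0 : (0 < n)%N by lia.
have coh1 : 1 <= coherence Ubar := coherence_ge1 hd n_gt0 hUbar.
have hq' : 64 / 3 * ln n%:R ^+ 2 * d%:R * coherence Ubar * ln (20 * d%:R) <= q.
  apply: le_trans hq; rewrite !ler_wpM2r ?sqr_ge0//.
    by apply: ln_ge0; have : 1 <= d%:R :> R; [rewrite ler1n|lra].
  by apply: le_trans coh1; exact: ler01.
have q_gt0 := sample_bound_gt0 hd hn hUbar hq'.
have q_le := sample_bound_le hrun hOm t.
have [p [p_gt0 Lp dp]] := choose_moment hd n_ge2 coh1 q_le hq'.
set e := error U Ubar t; set e' := error U Ubar t.+1.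
pose F y := y - (32 / 100) * (6 / 10 - delta) * (q / (n%:R * d%:R)) * y
           + 55 * Num.sqrt (n%:R / q) * y `^ (3 / 2).
have [ie' iY mY YE] := hY.
have e0 x : 0 <= e x := error_ge0 hUbar hrun t x.
have e32 x : e x `^ (3 / 2) = e x * Num.sqrt (e x).
  have -> : 3 / 2 = 1 + 2^-1 :> R by lra.
  rewrite powRD; last by apply/implyP => /eqP; lra.
  by rewrite powRr1// powR12_sqrt.
have be : bmf e := bmf_error hrun t.
have bF : bmf (F \o e).
  apply: bmfD.
    by apply: bmfD => //; apply: bmfN; apply: bmfM => //; exact: bmf_cst.
  apply: bmfM; first exact: bmf_cst.
  rewrite (_ : (fun _ => _) = fun x => e x * Num.sqrt (e x)); last exact/funext.
  exact: bmf_pow32.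
(* The exceptional event. Both [e] and the version [Y] are measurable for the sigma-algebra of [e],
   so [Y] may be replaced by [e'] in the integral over [A]. *)
pose A := [set x | F (e x) < Y x /\ small_error Ubar q (e x)].
have sA : sigma_of e A.
  pose ST := g_sigma_algebra_preimageType e.
  have me : measurable_fun setT (e : ST -> R) by move=> _ B mB; exists B.
  have mYe : measurable_fun setT (Y : ST -> R) by move=> _ B mB; apply: mY; exists B.
  have mF : measurable_fun setT (F : R -> R).
    apply: measurable_funD; last by apply: measurable_funM => //; exact: measurable_powR.
    by apply: measurable_funB => //; apply: measurable_funM.
  have mlt : measurable ([set x | F (e x) < Y x] : set ST).
    have := measurable_fun_ltr (measurableT_comp mF me) mYe.
    by move=> /(_ measurableT [set true] Logic.I); rewrite setTI.
  have mle (c : R) : measurable ([set x | e x <= c] : set ST).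
    have := measurable_fun_ler me (measurable_cst c).
    by move=> /(_ measurableT [set true] Logic.I); rewrite setTI.
  by apply: (@measurableI _ ST) => //; apply: (@measurableI _ ST); apply: mle.
(* The error is a function of [U_t], so its sigma-algebra is part of the history. *)
have hA : history U s Om t A.
  have [B mB <-] := sA.
  exact: (proj1 (history_error hrun t)).
have mA : measurable A.
  apply: (smallest_sub (sigma_algebra_measurable T) _ hA).
  exact: history_gen_measurable (grouse_Om_measurable hrun).
have aeA : {ae P, forall x, ~ A x}.
  apply: (ae_le_of_integral (f := Y) (g := F \o e)) => //.
  - exact: bmf_integrable.
  - by move=> x [].
  rewrite /Rintegral YE// -/(Rintegral P A e') -/(Rintegral P A (F \o e)).
  rewrite (Rintegral_indic_mul P A e') (Rintegral_indic_mul P A (F \o e)).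
  have h := expected_error_event hd hn hUbar hrun hs hOm hq' hstep hA
    (fun x => @proj2 _ _) p_gt0 Lp dp.
  apply: le_trans h _.
  have bA : bmf (\1_A : T -> R) := bmf_indic mA.
  have b32 := bmf_pow32 e0 be.
  apply: Rexp_le.
  - apply: bmfM => //; apply: bmfD.
      apply: bmfD => //; apply: bmfM; first exact: bmf_cst.
      by apply: bmfM => //; exact: bmf_cst.
    by apply: bmfN; apply: bmfM => //; exact: bmf_cst.
  - exact: bmfM.
  move=> x; apply: ler_wpM2l; first by rewrite indicE ler0n.
  have c0 : 0 <= q / (n%:R * d%:R) * e x.
    by rewrite mulr_ge0 ?e0// divr_ge0 ?mulr_ge0// ltW.
  have k0 : 0 <= Num.sqrt (n%:R / q) * (e x * Num.sqrt (e x)).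
    by rewrite !mulr_ge0 ?sqrtr_ge0 ?e0.
  rewrite /= /F e32 -/e -!mulrA; move: c0 k0; rewrite -!mulrA.
  set c := q * _; set k := Num.sqrt _ * _ => c0 k0.
  (* It remains to compare constants: [(32/100) (6/10 - delta) <= 0.192 < 32/81] and [10 <= 55]. *)
  have : delta * c >= 0 by rewrite mulr_ge0//; case/andP: hdelta => /ltW.
  lra.
apply: filterS aeA => x nA small; rewrite leNgt; apply/negP => lt.
by apply: nA; split.
Qed.
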